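(* Let $q=p^e$ be a power of a prime $p$, let $d\geq 2$ be an even integer with $q\equiv 1 \pmod{2d(d-1)}$, and let $a,b\in\mathbb{F}_q^\times$. Let $N'_d=\#\{(x,y)\in\mathbb{F}_q^2 : y^2=x^d+ax^{d-1}+b\}$. Let $T$ be a generator of $\widehat{\mathbb{F}_q^\times}$ and put $\chi=T^{\frac{q-1}{d}}$ (order $d$) and $\psi=T^{\frac{q-1}{2(d-1)}}$ (order $2(d-1)$). Then $$N'_d=q+\phi(b)+q^{\frac d2}\,\phi(d-1)\;{}_{d}F_{d-1}\!\left(\begin{array}{c}A_0,A_1,\ldots,A_{d-1}\\ B_1,\ldots,B_{d-1}\end{array}\Big|\ \beta\right),$$ where $\beta=\dfrac{bd^d}{a^d(d-1)^{d-1}}$, $A_0=\phi$, $A_1=\varepsilon$, $B_1=\phi$, and the remaining $d-2$ pairs $(A_i,B_i)$, $i=2,\ldots,d-1$, are the pairs $(\chi^j,\psi^{2j-1})$ for $j\in\{1,\ldots,d-1\}\setminus\{d/2\}$ in increasing order of $j$; i.e. the top row is $\phi,\varepsilon,\chi,\chi^2,\ldots,\chi^{\frac{d-2}{2}},\chi^{\frac{d+2}{2}},\ldots,\chi^{d-1}$ and the bottom row is $\phi,\psi,\psi^3,\ldots,\psi^{d-3},\psi^{d+1},\ldots,\psi^{2d-3}$.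
   Context: $\widehat{\mathbb{F}_q^\times}$ denotes the group of multiplicative characters of $\mathbb{F}_q^\times$; every character (including the trivial one) is extended to $\mathbb{F}_q$ by setting $\chi(0)=0$. $\varepsilon$ is the trivial character and $\phi$ the quadratic character. For characters $A,B$, $\overline{B}$ is the inverse of $B$ and $${A\choose B}:=\frac{B(-1)}{q}\sum_{x\in\mathbb{F}_q}A(x)\overline{B}(1-x).$$ For characters $A_0,\ldots,A_n,B_1,\ldots,B_n$ and $x\in\mathbb{F}_q$, the Gaussian hypergeometric series is $${}_{n+1}F_n\!\left(\begin{array}{c}A_0,A_1,\ldots,A_n\\ B_1,\ldots,B_n\end{array}\Big|\ x\right):=\frac{q}{q-1}\sum_{\chi}{A_0\chi\choose\chi}{A_1\chi\choose B_1\chi}\cdots{A_n\chi\choose B_n\chi}\chi(x),$$ the sum over all multiplicative characters $\chi$ of $\mathbb{F}_q$. *)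

(* Defs.v *)
From HB Require Import structures.
From mathcomp Require Import all_boot all_order all_algebra all_fingroup all_solvable all_field all_character.
Set Implicit Arguments. Unset Strict Implicit. Unset Printing Implicit Defensive.
Import GRing.Theory Num.Theory.
Local Open Scope ring_scope.

Definition UG (F : finFieldType) := [set: {unit F}]%G.

Definition mch (F : finFieldType) (xi : 'CF(UG F)) : F -> algC :=
  fun x => match insub x with Some u => xi u | None => 0 end.

Definition epsc (F : finFieldType) : F -> algC :=
  fun x => if x == 0 then 0 else 1.

Definition phiq (F : finFieldType) : F -> algC :=
  fun x => if x == 0 then 0 else if [exists y : F, y ^+ 2 == x] then 1 else -1.

(* (A choose B) = B(-1)/q * sum_x A(x) Bbar(1-x);  Bbar(x) = B(x)^-1 (0^-1 = 0 in algC) *)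
Definition jbin (F : finFieldType) (A B : F -> algC) : algC :=
  B (-1) / (#|F|%:R) * \sum_(x : F) A x * (B (1 - x))^-1.

Definition cmul (F : finFieldType) (A B : F -> algC) : F -> algC := fun x => A x * B x.

(* Gaussian hypergeometric series  _{n+1}F_n(A0, A1..An; B1..Bn | x);
   ABs = [:: (A1,B1); ...; (An,Bn)]; the sum runs over all multiplicative
   characters of F_q^x, i.e. the irreducible (= linear) characters of UG F. *)
Definition HGF (F : finFieldType) (A0 : F -> algC) (ABs : seq ((F -> algC) * (F -> algC))) (x : F) : algC :=
  (#|F|%:R) / ((#|F|)%:R - 1) *
  \sum_(i : Iirr (UG F))
     (jbin (cmul A0 (mch 'chi_i)) (mch 'chi_i) *
      \prod_(AB <- ABs) jbin (cmul AB.1 (mch 'chi_i)) (cmul AB.2 (mch 'chi_i)) *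
      mch 'chi_i x).

(* Main.v *)
(* Both sides, as functions of b, are expanded in multiplicative characters eta.  On the side of
   the curve, multiplying by g(phi) turns the quadratic character into additive ones, and the
   eta-coefficient becomes a product of Gauss sums of eta^d, (phi eta)^(1-d) and 1 / eta.  On the
   hypergeometric side every binomial coefficient is a quotient of Gauss sums, with nontrivial
   denominator, and the coefficient is a product of Gauss sums of eta times the powers of chi, and
   of 1 / eta times the odd powers of 1 / psi.  The Hasse-Davenport product formula
     prod_(j < m) g(chi^j eta) = eta(m)^(-m) g(eta^m) prod_(1 <= j < m) g(chi^j),
   with m = d and with m = d - 1, collapses the latter to the former.

   The product formula is proved by comparing L-functions.  For monic f over F_q with roots r_i,
   let Lambda_m(f) = eta(prod r_i^m) theta(sum r_i^m).  The pullback under x |-> x^m gives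
     sum_f Lambda_m(f) u^(deg f) = prod_(j < m) (1 + g(chi^j eta) u),
   which is read off the logarithmic derivatives, i.e. sums over the fields F_(q^k).  The
   coefficient of u^m on the left factors, since by Newton's identities the m-th power sum of the
   roots of f + c is that of f minus m c: it is eta(m)^(-m) g(eta^m) times a constant that does
   not depend on eta. *)
Require Import Defs.
From HB Require Import structures.
From mathcomp Require Import all_boot all_order all_algebra all_fingroup all_solvable all_field all_character.
From mathcomp Require Import ring zify.
Set Implicit Arguments. Unset Strict Implicit. Unset Printing Implicit Defensive.
Import GRing.Theory Num.Theory.
Local Open Scope ring_scope.

(** * Newton's identities *)

Section NewtonPairs.
Variable R : comNzRingType.
Implicit Types (c p : nat -> R) (s : seq R).

(* Coefficientwise up to degree [n], with [C] and [P] the generating series of [c] and [p]: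
   [C(0) = 1] and ['X * C' = - P * C]. *)
Definition newton_pair n c p : Prop :=
  c 0 = 1 /\ forall k, (k <= n)%N ->
    k%:R * c k = - \sum_(i < k) p i.+1 * c (k - i.+1)%N.

Lemma newton_pairW m n c p : (m <= n)%N -> newton_pair n c p -> newton_pair m c p.
Proof. by move=> mn [c0 cp]; split=> // k km; apply/cp/(leq_trans km). Qed.

Lemma newton_pair_top n c p c' p' :
    newton_pair n.+1 c p -> newton_pair n.+1 c' p' -> (forall i, (i <= n)%N -> c i = c' i) ->
  p n.+1 + n.+1%:R * c n.+1 = p' n.+1 + n.+1%:R * c' n.+1.
Proof.
elim/ltn_ind: n => n IHn cp cp' cc.
have pp i : (i < n)%N -> p i.+1 = p' i.+1.
  move=> ltin; have := IHn i ltin (newton_pairW (leqW ltin) cp) (newton_pairW (leqW ltin) cp').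
  rewrite cc // => /(_ _)/addIr; apply=> j ji.
  by apply: cc; apply: leq_trans ji (ltnW ltin).
have [[c0 ->] // [c'0 ->] //] := (cp, cp').
rewrite !big_ord_recr /= !subnn c0 c'0 !mulr1 !opprD ![p _ + _]addrC ![p' _ + _]addrC !subrK.
by congr (- _); apply: eq_bigr => i _; rewrite pp // cc // subSS leq_subr.
Qed.

Lemma newton_pair_eq_power n c p c' p' :
    newton_pair n c p -> newton_pair n c' p' -> (forall i, (i <= n)%N -> c i = c' i) ->
  (0 < n)%N -> p n = p' n.
Proof.
case: n => // n cp cp' cc _; have := newton_pair_top cp cp'.
by rewrite cc // => /(_ _)/addIr; apply=> i /leqW; apply: cc.
Qed.

Definition rev_prod s : {poly R} := \prod_(x <- s) (1 - x *: 'X).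
Definition power_sum s k : R := \sum_(x <- s) x ^+ k.

Lemma coef0_rev_prod s : (rev_prod s)`_0 = 1.
Proof.
rewrite /rev_prod coef0_prod big1 // => x _.
by rewrite coefB coef1 coefZ coefX mulr0 subr0.
Qed.

Lemma coefS_rev_prod_cons x s i :
  (rev_prod (x :: s))`_i.+1 = (rev_prod s)`_i.+1 - x * (rev_prod s)`_i.
Proof. by rewrite /rev_prod big_cons mulrBl mul1r -scalerAl coefB coefZ coefXM. Qed.

Lemma size_rev_prod s : (size (rev_prod s) <= (size s).+1)%N.
Proof.
elim: s => [|x s IHs]; first by rewrite /rev_prod big_nil size_poly1.
apply/leq_sizeP => -[//|j] /= sj; rewrite coefS_rev_prod_cons.
by rewrite !nth_default ?mulr0 ?subr0 // (leq_trans IHs) // ltnW.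
Qed.

(* [rev_prod s] is the quotient of [rev_prod (x :: s)] by [1 - x 'X]. *)
Lemma sum_coef_rev_prod_cons x s n :
  \sum_(i < n.+1) x ^+ i.+1 * (rev_prod (x :: s))`_(n - i) = x * (rev_prod s)`_n.
Proof.
elim: n => [|n IHn]; first by rewrite big_ord1 !coef0_rev_prod.
rewrite big_ord_recl subn0 coefS_rev_prod_cons.
under eq_bigr => i _ do rewrite lift0 exprS -mulrA subSS.
by rewrite -mulr_sumr IHn; ring.
Qed.

Lemma newton_pair_rev_prod s n : newton_pair n (fun i => (rev_prod s)`_i) (power_sum s).
Proof.
split=> [|k _]; first exact: coef0_rev_prod.
elim: s k => [|x s IHs] k.
  rewrite big1 => [|i _]; last by rewrite /power_sum big_nil mul0r.
  by rewrite oppr0 /rev_prod big_nil coef1; case: k => [|k]; rewrite ?mul0r ?mulr0.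
case: k => [|k]; first by rewrite mul0r big_ord0 oppr0.
have split_head i : power_sum (x :: s) i.+1 = x ^+ i.+1 + power_sum s i.+1.
  by rewrite /power_sum big_cons.
under eq_bigr => i _ do rewrite split_head mulrDl subSS.
rewrite big_split /= sum_coef_rev_prod_cons.
have -> : \sum_(i < k.+1) power_sum s i.+1 * (rev_prod (x :: s))`_(k - i) =
    \sum_(i < k.+1) power_sum s i.+1 * (rev_prod s)`_(k.+1 - i.+1)
    - x * \sum_(i < k) power_sum s i.+1 * (rev_prod s)`_(k - i.+1).
  rewrite !big_ord_recr /= subSS subnn !coef0_rev_prod mulr_sumr addrAC -sumrB; congr (_ + _).
  apply: eq_bigr => i _; rewrite subSS -(subnSK (ltn_ord i)) coefS_rev_prod_cons; ring.
by rewrite coefS_rev_prod_cons -[\sum_(i < k.+1) _]opprK -[\sum_(i < k) _]opprK -!IHs; ring.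
Qed.

Lemma coef_prod_XsubC_rev s j : (j <= size s)%N ->
  (\prod_(x <- s) ('X - x%:P))`_(size s - j) = (rev_prod s)`_j.
Proof.
elim: s j => [|x s IHs] [|j] //= js.
- by rewrite big_nil coef1 coef0_rev_prod.
- rewrite coef0_rev_prod subn0; have := monic_prod_XsubC (x :: s) xpredT id.
  by rewrite monicE lead_coefE size_prod_XsubC => /eqP.
rewrite big_cons mulrBl coefB coefXM coefCM coefS_rev_prod_cons subSS IHs //.
have [->|jn] := eqVneq j (size s).
  by rewrite subnn [_`_(size s).+1]nth_default ?size_rev_prod.
have {js jn}js : (j < size s)%N by rewrite ltn_neqAle jn.
by rewrite subn_eq0 leqNgt js /= -subnS IHs.
Qed.

End NewtonPairs.

Lemma newton_pair_eq_coef (R : numDomainType) n (c p c' p' : nat -> R) :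
    newton_pair n c p -> newton_pair n c' p' -> (forall k, (0 < k <= n)%N -> p k = p' k) ->
  forall k, (k <= n)%N -> c k = c' k.
Proof.
move=> [c0 cp] [c'0 cp'] pp k; elim/ltn_ind: k => -[|k] IHk kn; first by rewrite c0 c'0.
have k0 : k.+1%:R != 0 :> R by rewrite pnatr_eq0.
apply: (mulfI k0); rewrite cp // cp' //; congr (- _); apply: eq_bigr => i _.
by have ik := ltn_ord i; rewrite pp ?IHk //; lia.
Qed.

(** * Finite fields and their splitting fields *)

Lemma prim_root_neq0 (R : idomainType) n (z : R) : n.-primitive_root z -> z != 0.
Proof. by move=> z_prim; rewrite (prim_root_eq0 z_prim) -lt0n (prim_order_gt0 z_prim). Qed.

Section FiniteFields.
Variable F : finFieldType.

Lemma card_finField_expr_pred k : (#|F| ^ k = (#|F| ^ k - 1).+1)%N.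
Proof. by rewrite subn1 prednK // expn_gt0 ltnW ?finNzRing_gt1. Qed.

Lemma expf_pred_card (x : F) : x != 0 -> x ^+ (#|F| - 1) = 1.
Proof.
move=> x0; apply: (mulfI x0); rewrite -exprS mulr1 subn1 prednK ?expf_card //.
exact: ltnW (finNzRing_gt1 F).
Qed.

Lemma natr_card_finField : #|F|%:R = 0 :> F.
Proof. by rewrite -FinRing.zmodXgE -cardsT expg_cardG ?inE. Qed.

Lemma pnat_card_finField : [pchar F].-nat #|F|.
Proof.
have [p pr_p pF] := finPcharP F.
have := abelem_pgroup (fin_ring_pchar_abelem pF).
by rewrite /pgroup cardsT (eq_pnat _ (pcharf_eq pF)).
Qed.

Lemma natr_dvd_pred_expn_neq0 k n : (0 < k)%N -> (n %| #|F| ^ k - 1)%N -> n%:R != 0 :> F.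
Proof.
move=> k0 /dvdnP[a aE]; have : (#|F| ^ k - 1)%:R != 0 :> F.
  have qk0 : (#|F| ^ k)%:R = 0 :> F by rewrite natrX natr_card_finField expr0n gtn_eqF.
  apply: contra_neq (oner_neq0 F) => pred0.
  by rewrite -qk0 card_finField_expr_pred -natr1 pred0 add0r.
by rewrite aE natrM mulf_eq0 negb_or => /andP[].
Qed.

Lemma natr_dvd_pred_neq0 n : (n %| #|F| - 1)%N -> n%:R != 0 :> F.
Proof. by rewrite -[#|F|]expn1; apply: natr_dvd_pred_expn_neq0. Qed.

Lemma finField_prim_root : exists g : F, (#|F| - 1).-primitive_root g.
Proof.
have /hasP[g _ g_prim] : has (#|F| - 1).-primitive_root (enum (predC1 (0 : F))); last by exists g.
apply: has_prim_root; first by rewrite subn_gt0 finNzRing_gt1.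
- by apply/allP => x; rewrite mem_enum => x0; apply/unity_rootP/expf_pred_card.
- exact: enum_uniq.
by rewrite -cardE cardC1 subn1.
Qed.

End FiniteFields.

Definition splits (F L : fieldType) (iota : {rmorphism F -> L}) (f : {poly F}) : Prop :=
  exists s : seq L, map_poly iota f = \prod_(r <- s) ('X - r%:P).

Lemma splits_seq (F : finFieldType) (fs : seq {poly F}) : all (fun f => f \is monic) fs ->
  exists (L : finFieldType) (iota : {rmorphism F -> L}), {in fs, forall f, splits iota f}.
Proof.
move=> /allP fs_monic; pose p := \prod_(f <- fs) f.
have p0 : p != 0 by apply: monic_neq0; rewrite /p big_seq monic_prod.
have [L [s p_split _]] := FinSplittingFieldFor p0.
exists (FinFieldExtType L), (in_alg L) => f ffs.
have : map_poly (in_alg L) f %| \prod_(r <- s) ('X - r%:P).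
  by rewrite -(eqp_dvdr _ p_split) dvdp_map /p (big_rem f) //= dvdp_mulIl.
move=> /dvdp_prod_XsubC[mask_f Hf]; exists (mask mask_f s); apply/eqP.
by rewrite -eqp_monic ?map_monic ?fs_monic // monic_prod_XsubC.
Qed.

Lemma splits_prim_root (F L : fieldType) (iota : {rmorphism F -> L}) n :
  n%:R != 0 :> F -> splits iota ('X^n - 1) -> exists z : L, n.-primitive_root z.
Proof.
move=> nF [rs]; rewrite rmorphB rmorph1 rmorphXn /= map_polyX => rsE.
have n0 : (0 < n)%N by case: n nF {rsE} => //; rewrite eqxx.
have /hasP[z _ z_prim] : has n.-primitive_root rs; last by exists z.
apply: has_prim_root => //.
- by apply/allP => z; rewrite /root_of_unity -root_prod_XsubC -rsE.
- rewrite -separable_prod_XsubC -rsE cyclotomic.separable_Xn_sub_1 //.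
  by rewrite -(rmorph_nat iota) fmorph_eq0.
by rewrite -ltnS -(size_prod_XsubC rs id) -rsE size_XnsubC.
Qed.

Lemma splitting_tower (F : finFieldType) (m : nat) :
  exists (L : finFieldType) (iota : {rmorphism F -> L}),
    (forall f, f \is monic -> (size f <= m.+1)%N -> splits iota f) /\
    (forall k, (0 < k <= m)%N -> exists z : L, (#|F| ^ k - 1).-primitive_root z).
Proof.
pose small := [seq f <- [seq rVpoly v | v : 'rV[F]_m.+1] | f \is monic].
pose cyclic : seq {poly F} := [seq 'X^(#|F| ^ k - 1) - 1 | k <- iota 1 m].
have order_gt0 k : (0 < k)%N -> (0 < #|F| ^ k - 1)%N.
  by move=> k0; rewrite subn_gt0 -(exp1n k) ltn_exp2r ?finNzRing_gt1.
have [|L [incl Lsplit]] := @splits_seq F (small ++ cyclic).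
  rewrite all_cat filter_all; apply/allP => _ /mapP[k + ->].
  by rewrite mem_iota => /andP[/order_gt0 k0 _]; apply: monicXnsubC.
exists L, incl; split=> [f f_monic fm|k /andP[k0 km]].
  apply: Lsplit; rewrite mem_cat mem_filter f_monic.
  by rewrite -(poly_rV_K fm) codom_f.
apply: (@splits_prim_root _ _ incl); first exact: natr_dvd_pred_expn_neq0 k0 (dvdnn _).
apply: Lsplit; rewrite mem_cat; apply/orP; right; apply/mapP; exists k => //.
by rewrite mem_iota k0 add1n ltnS.
Qed.

(** * Monic polynomials of given degree *)

Section MonicPolynomials.
Variable R : nzRingType.

Definition monic_rV n (v : 'rV[R]_n) : {poly R} := 'X^n + rVpoly v.

Lemma size_monic_rV n (v : 'rV[R]_n) : size (monic_rV v) = n.+1.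
Proof. by rewrite size_polyDl size_polyXn // ltnS size_poly. Qed.

Lemma monic_rV_monic n (v : 'rV[R]_n) : monic_rV v \is monic.
Proof. by rewrite monicE lead_coefDl ?lead_coefXn // size_polyXn ltnS size_poly. Qed.

Lemma coef_monic_rV n (v : 'rV[R]_n) (i : 'I_n) : (monic_rV v)`_i = v 0 i.
Proof. by rewrite coefD coefXn ltn_eqF // add0r coef_rVpoly_ord. Qed.

Lemma monic_rV_inj n : injective (@monic_rV n).
Proof. by move=> u v /addrI /(can_inj rVpolyK). Qed.

Lemma monic_rV_addC n (v : 'rV[R]_n) c : (0 < n)%N ->
  monic_rV (v + poly_rV c%:P) = monic_rV v + c%:P.
Proof.
move=> n0; rewrite /monic_rV raddfD /= poly_rV_K ?addrA //.
exact: leq_trans (size_polyC_leq1 c) n0.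
Qed.

Lemma monic_rV_poly_rV n (f : {poly R}) : f \is monic -> size f = n.+1 ->
  monic_rV (poly_rV (f - 'X^n) : 'rV_n) = f.
Proof.
move=> /monicP f_lead sf; rewrite /monic_rV poly_rV_K ?subrKC //.
apply/leq_sizeP => j; rewrite leq_eqVlt coefB coefXn => /predU1P[<-|nj].
  by move: f_lead; rewrite lead_coefE sf eqxx /= => ->; rewrite subrr.
by rewrite nth_default ?sf // gtn_eqF ?subrr.
Qed.

End MonicPolynomials.

Lemma sum_monic_dvd (F : finFieldType) (V : nmodType) (G : {poly F} -> V) n k (P : {poly F}) :
  P \is monic -> size P = k.+1 -> (k <= n)%N ->
  \sum_(v : 'rV[F]_n | P %| monic_rV v) G (monic_rV v)
  = \sum_(w : 'rV[F]_(n - k)) G (P * monic_rV w).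
Proof.
move=> P_monic sP kn; have P0 := monic_neq0 P_monic.
pose mulP (w : 'rV[F]_(n - k)) : 'rV[F]_n := poly_rV (P * monic_rV w - 'X^n).
pose divP (v : 'rV[F]_n) : 'rV[F]_(n - k) := poly_rV (monic_rV v %/ P - 'X^(n - k)).
have mulPE w : monic_rV (mulP w) = P * monic_rV w.
  apply: monic_rV_poly_rV; first by rewrite monicMl // monic_rV_monic.
  by rewrite size_monicM ?monic_neq0 ?monic_rV_monic // sP size_monic_rV addSn addnS subnKC.
have divPE v : P %| monic_rV v -> P * monic_rV (divP v) = monic_rV v.
  move=> /dvdpP[g gE].
  have g_monic : g \is monic by rewrite -(monicMr _ P_monic) -gE monic_rV_monic.
  rewrite /divP gE mulpK // monic_rV_poly_rV 1?mulrC //.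
  by have := size_monic_rV v; rewrite gE size_Mmonic ?monic_neq0 // sP; move: (size g); lia.
rewrite (reindex_onto mulP divP) => [|v Pv]; last by apply: monic_rV_inj; rewrite mulPE divPE.
apply: eq_big => [w|w _]; last by rewrite mulPE.
rewrite mulPE dvdp_mulr //=; apply/eqP/monic_rV_inj/(mulfI P0).
by rewrite divPE mulPE // dvdp_mulr.
Qed.

(** * Multiplicities of roots and Frobenius orbits *)

Lemma dvdp_prod_XsubCP (L : fieldType) (s : seq L) (p : {poly L}) : p != 0 ->
  reflect {in s, forall x, count_mem x s <= mup x p}%N (\prod_(x <- s) ('X - x%:P) %| p).
Proof.
move=> p0; apply: (iffP idP) => [dvd x _|].
  rewrite mup_geq //; apply: dvdp_trans dvd; rewrite -mup_geq ?mu_prod_XsubC //.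
  by rewrite monic_neq0 // monic_prod_XsubC.
elim: s p p0 => [|x s IHs] p p0 cnt; first by rewrite big_nil dvd1p.
have : ('X - x%:P) ^+ 1 %| p.
  by rewrite -mup_geq // (leq_trans _ (cnt x (mem_head _ _))) //= eqxx.
move=> /dvdpP[g pE]; have := p0; rewrite pE mulf_eq0 negb_or => /andP[g0 _].
rewrite big_cons mulrC; apply: dvdp_mul => //; apply: (IHs g g0) => y ys.
have := cnt y (mem_behead (s := x :: s) ys).
by rewrite pE mupM // ?expf_neq0 ?polyXsubC_eq0 // mup_XsubCX /=; case: eqP; lia.
Qed.

Lemma mup_map_poly (K L : fieldType) (h : {rmorphism K -> L}) (p : {poly K}) x : p != 0 ->
  mup (h x) (map_poly h p) = mup x p.
Proof.
move=> p0; have hp0 : map_poly h p != 0 by rewrite map_poly_eq0.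
have mup_geqE n : (n <= mup (h x) (map_poly h p))%N = (n <= mup x p)%N.
  by rewrite !mup_geq // -[RHS](dvdp_map h) rmorphXn rmorphB /= map_polyX map_polyC.
by apply/eqP; rewrite eqn_leq -mup_geqE leqnn mup_geqE leqnn.
Qed.

Lemma map_prod_XsubC (R S : comNzRingType) (h : {rmorphism R -> S}) (s : seq R) :
  map_poly h (\prod_(x <- s) ('X - x%:P)) = \prod_(x <- map h s) ('X - x%:P).
Proof.
rewrite rmorph_prod big_map; apply: eq_bigr => x _.
by rewrite rmorphB /= map_polyX map_polyC.
Qed.

Lemma sum_count_mem (V : nmodType) (I : finType) (G : I -> V) (s : seq I) :
  \sum_x G x *+ count_mem x s = \sum_(x <- s) G x.
Proof.
elim: s => [|y s IHs]; first by rewrite big_nil big1.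
rewrite big_cons -IHs; under eq_bigr => x _ do rewrite mulrnDr.
rewrite big_split /=; congr (_ + _); rewrite (bigD1 y) //= eqxx big1 ?addr0 // => x xy.
by rewrite eq_sym (negPf xy).
Qed.

Section Orbits.
Variables (T : finType) (f : T -> T).
Hypothesis f_inj : injective f.

Lemma iter_mul_order x j : iter (j * fingraph.order f x) f x = x.
Proof. by elim: j => // j IHj; rewrite mulSn iterD IHj iter_order. Qed.

Lemma iter_eq_order x k : (iter k f x == x) = (fingraph.order f x %| k)%N.
Proof.
apply/eqP/dvdnP => [xk|[j ->]]; last exact: iter_mul_order.
set r := fingraph.order f x; exists (k %/ r)%N; rewrite [LHS](divn_eq k r).
have k_mod_r : (k %% r < r)%N by rewrite ltn_mod fingraph.order_gt0.
suff -> : (k %% r = 0)%N by rewrite addn0.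
rewrite -(findex_iter k_mod_r) -{2}(iter_mul_order x (k %/ r)) -iterD addnC -divn_eq xk.
exact: findex0.
Qed.

Lemma count_traject_mul_order x y j :
  count_mem y (traject f x (j * fingraph.order f x)) = (j * (y \in fingraph.orbit f x))%N.
Proof.
elim: j => //= j IHj; rewrite !mulSn trajectD iter_order // count_cat IHj.
by rewrite -/(fingraph.orbit f x) count_uniq_mem ?orbit_uniq.
Qed.

End Orbits.

Section Frobenius.
Variables (F L : finFieldType) (iota : {rmorphism F -> L}).
Implicit Types (f g : {poly F}) (s : seq L) (x y : L).

(* The morphism argument makes the ring-morphism structure inferable. *)
Definition frob of {rmorphism F -> L} := fun x => x ^+ #|F|.

Lemma frob_is_zmod_morphism : zmod_morphism (frob iota).
Proof.
move=> x y; rewrite /frob.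
have qL : [pchar L].-nat #|F|.
  by rewrite (eq_pnat _ (fmorph_pchar iota)) pnat_card_finField.
apply/(addIr (y ^+ #|F|)); rewrite subrK.
by rewrite -exprDn_pchar // subrK.
Qed.

Lemma frob_is_monoid_morphism : monoid_morphism (frob iota).
Proof. by split=> [|x y]; rewrite /frob ?expr1n ?exprMn. Qed.

HB.instance Definition _ := GRing.isZmodMorphism.Build L L (frob iota) frob_is_zmod_morphism.
HB.instance Definition _ := GRing.isMonoidMorphism.Build L L (frob iota) frob_is_monoid_morphism.

Local Notation fr := (frob iota).
Local Notation "p ^iota" := (map_poly iota p) (at level 2, format "p ^iota").

Lemma frob_inj : injective fr.
Proof. exact: fmorph_inj. Qed.

Lemma frob_iota (z : F) : fr (iota z) = iota z.
Proof. by rewrite /frob -rmorphXn /= expf_card. Qed.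

Lemma frob_fixedP x : reflect (exists z, x = iota z) (fr x == x).
Proof.
apply: (iffP eqP) => [frx|[z ->]]; last exact: frob_iota.
have : root ('X^#|F| - 'X)^iota x.
  by rewrite rmorphB rmorphXn /= map_polyX rootE !hornerE -/(fr x) frx subrr.
rewrite finField_genPoly rmorph_prod /=.
under eq_bigr => z _ do rewrite rmorphB /= map_polyX map_polyC.
rewrite -big_enum -(big_map iota xpredT (fun r => 'X - r%:P)) root_prod_XsubC.
by case/mapP => z _ ->; exists z.
Qed.

Lemma iter_frobE x k : iter k fr x = x ^+ (#|F| ^ k).
Proof. by elim: k => //= k ->; rewrite /frob -exprM expnSr. Qed.

Lemma iter_frobX x k n : iter k fr (x ^+ n) = iter k fr x ^+ n.
Proof. by rewrite !iter_frobE exprAC. Qed.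

Lemma mup_frob f x : f != 0 -> mup (fr x) f^iota = mup x f^iota.
Proof.
move=> f0; rewrite -[RHS](mup_map_poly fr) ?map_poly_eq0 //; congr mup.
by apply/polyP => i; rewrite !coef_map /= frob_iota.
Qed.

Definition iota_inv x : F := odflt 0 [pick z | iota z == x].

Lemma iotaK : cancel iota iota_inv.
Proof.
move=> z; rewrite /iota_inv; case: pickP => [w /eqP/fmorph_inj //|/(_ z)].
by rewrite eqxx.
Qed.

Lemma iota_invK x : fr x = x -> iota (iota_inv x) = x.
Proof. by move=> /eqP/frob_fixedP[z ->]; rewrite iotaK. Qed.

Lemma map_poly_iota_inv (p : {poly L}) : map_poly fr p = p -> (map_poly iota_inv p)^iota = p.
Proof.
move=> frp; apply/polyP => i; rewrite coef_map /= coef_map_id0 ?iota_invK //.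
  by rewrite -[in RHS]frp coef_map.
by rewrite -(rmorph0 iota) iotaK.
Qed.

Definition orbit_poly k x : {poly L} := \prod_(y <- traject fr x k) ('X - y%:P).
Definition norm_poly k x : {poly F} := map_poly iota_inv (orbit_poly k x).

Lemma map_norm_poly k x : iter k fr x = x -> (norm_poly k x)^iota = orbit_poly k x.
Proof.
have map_traject n y : map fr (traject fr y n) = traject fr (fr y) n.
  by elim: n y => //= n IHn y; rewrite IHn.
move=> xk; apply: map_poly_iota_inv; rewrite map_prod_XsubC; apply: perm_big.
by case: k xk => // k xk; rewrite map_traject trajectSr -iterSr xk perm_rcons.
Qed.

Lemma norm_poly_monic k x : iter k fr x = x -> norm_poly k x \is monic.
Proof. by move=> xk; rewrite -(map_monic iota) map_norm_poly // monic_prod_XsubC. Qed.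

Lemma size_norm_poly k x : iter k fr x = x -> size (norm_poly k x) = k.+1.
Proof.
by move=> xk; rewrite -(size_map_poly iota) map_norm_poly // size_prod_XsubC size_traject.
Qed.

Lemma norm_poly_dvd f x j : f != 0 ->
  (norm_poly (j * fingraph.order fr x) x %| f) = (j <= mup x f^iota)%N.
Proof.
move=> f0; rewrite -(dvdp_map iota) map_norm_poly; last exact/iter_mul_order/frob_inj.
have fi0 : f^iota != 0 by rewrite map_poly_eq0.
have mup_orbit y : y \in fingraph.orbit fr x -> mup y f^iota = mup x f^iota.
  rewrite -fconnect_orbit => /iter_findex <-.
  by elim: (findex _ _ _) => [//|i <-]; apply: mup_frob.
apply/(dvdp_prod_XsubCP _ fi0)/idP => [cnt|j_le y _]; last first.
  rewrite count_traject_mul_order; last exact: frob_inj.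
  have [/mup_orbit ->|_] := boolP (y \in fingraph.orbit fr x); last by rewrite muln0 leq0n.
  by rewrite muln1; exact: j_le.
case: j cnt => // j; have := count_traject_mul_order frob_inj x x j.+1.
rewrite in_orbit muln1 => count_x /(_ x); rewrite count_x; apply.
by rewrite -has_pred1 has_count count_x.
Qed.

(* When [x] is fixed by the [k]-th power of Frobenius, [norm_poly k x] is a power of the minimal
   polynomial of [x], so the [i] counted here are as many as the powers dividing [f]. *)
Lemma mup_eq_count_norm_poly f n x : size f = n.+1 ->
  mup x f^iota = (\sum_(i < n) ((iter i.+1 fr x == x) && (norm_poly i.+1 x %| f)%R))%N.
Proof.
move=> sf; have f0 : f != 0 by rewrite -size_poly_gt0 sf.
set e := mup x f^iota; set r := fingraph.order fr x.
have r0 : (0 < r)%N by rewrite fingraph.order_gt0.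
have er_le : (e * r <= n)%N.
  have := dvdp_leq f0 (etrans (norm_poly_dvd x e f0) (leqnn e)).
  by rewrite size_norm_poly ?sf //; exact/iter_mul_order/frob_inj.
have termE i : (iter i.+1 fr x == x) && (norm_poly i.+1 x %| f) =
    (r %| i.+1)%N && (i.+1 <= e * r)%N.
  rewrite iter_eq_order; last exact: frob_inj.
  case: (boolP (_ %| _)%N) => [/dvdnP[j ->]|//]; by rewrite norm_poly_dvd // leq_pmul2r.
under eq_bigr => i _ do rewrite termE.
rewrite -{1}(mulnK e r0) divn_count_dvd big_add1 /=.
rewrite -(big_mkord xpredT (fun i => nat_of_bool ((r %| i.+1) && (i < e * r))%N)).
rewrite [RHS](big_cat_nat (n := e * r)) //= [X in _ = (_ + X)%N]big1_seq ?addn0 => [|i].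
  by apply: eq_big_nat => i /andP[_ ->]; rewrite andbT.
by rewrite mem_index_iota => /andP[_ /andP[er_i _]]; rewrite ltnNge er_i andbF.
Qed.

Lemma size_split_roots f s n : f^iota = \prod_(r <- s) ('X - r%:P) -> size f = n.+1 -> size s = n.
Proof.
by move=> fs sf; apply: succn_inj; rewrite -(size_prod_XsubC s id) -fs size_map_poly.
Qed.

Lemma sum_mup_split (R : nzRingType) f n : splits iota f -> size f = n.+1 ->
  n%:R = \sum_(x : L) (mup x f^iota)%:R :> R.
Proof.
move=> [s fs] sf; rewrite -(size_split_roots fs sf).
under eq_bigr => x _ do rewrite fs mu_prod_XsubC.
by rewrite sum_count_mem -[1]/(1%:R) -natr_sum sum1_size.
Qed.

(** * Products and power sums of roots *)

Definition root_prod f : F := (-1) ^+ (size f).-1 * f`_0.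
Definition root_power_sum n f : F := iota_inv (\sum_(x : L) x ^+ n *+ mup x f^iota).

Lemma root_prod1 : root_prod 1 = 1.
Proof. by rewrite /root_prod size_poly1 expr0 mul1r coef1. Qed.

Lemma root_prodM f g : f \is monic -> g \is monic ->
  root_prod (f * g) = root_prod f * root_prod g.
Proof.
move=> f_monic g_monic; rewrite /root_prod coef0M size_monicM ?monic_neq0 //.
have f_size : (0 < size f)%N by rewrite size_poly_gt0 monic_neq0.
have g_size : (0 < size g)%N by rewrite size_poly_gt0 monic_neq0.
rewrite -(prednK f_size) -(prednK g_size) addSn addnS /= exprD; ring.
Qed.

Lemma iota_root_power_sum n f : f != 0 ->
  iota (root_power_sum n f) = \sum_(x : L) x ^+ n *+ mup x f^iota.
Proof.
move=> f0; rewrite iota_invK // rmorph_sum /=.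
rewrite [RHS](reindex_inj frob_inj) /=; apply: eq_bigr => x _.
by rewrite mup_frob // rmorphMn rmorphXn.
Qed.

Lemma root_power_sumM n f g : f \is monic -> g \is monic ->
  root_power_sum n (f * g) = root_power_sum n f + root_power_sum n g.
Proof.
move=> /monic_neq0 f0 /monic_neq0 g0; apply: (fmorph_inj iota).
rewrite rmorphD /= !iota_root_power_sum ?mulf_neq0 // -big_split /=.
by apply: eq_bigr => x _; rewrite rmorphM mupM ?map_poly_eq0 // mulrnDr.
Qed.

Lemma iota_root_power_sum_split n f s : f^iota = \prod_(r <- s) ('X - r%:P) ->
  iota (root_power_sum n f) = power_sum s n.
Proof.
move=> fs; have f0 : f != 0.
  by rewrite -(map_poly_eq0 iota) fs monic_neq0 // monic_prod_XsubC.
rewrite iota_root_power_sum // /power_sum -[RHS]sum_count_mem fs.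
by apply: eq_bigr => x _; rewrite mu_prod_XsubC.
Qed.

Lemma iota_root_prod_split f s : f^iota = \prod_(r <- s) ('X - r%:P) ->
  iota (root_prod f) = \prod_(r <- s) r.
Proof.
move=> fs; rewrite /root_prod rmorphM rmorphXn rmorphN1 /= -coef_map /= -(size_map_poly iota) fs.
by rewrite size_prod_XsubC coef0_prod_XsubC mulrA -expr2 sqrr_sign mul1r.
Qed.

Lemma root_power_sum1 n : root_power_sum n 1 = 0.
Proof.
apply: (fmorph_inj iota); rewrite rmorph0 (@iota_root_power_sum_split _ _ [::]).
  by rewrite /power_sum big_nil.
by rewrite rmorph1 big_nil.
Qed.

Lemma iota_coef_split f s j : (j <= size s)%N -> f^iota = \prod_(r <- s) ('X - r%:P) ->
  iota f`_(size s - j) = (rev_prod s)`_j.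
Proof. by move=> js fs; rewrite -coef_map /= fs coef_prod_XsubC_rev. Qed.

Lemma root_power_sum_linear n f : splits iota f -> size f = n.+2 ->
  root_power_sum 1 f = - f`_n.
Proof.
move=> [s fs] sf; have ss := size_split_roots fs sf.
apply: (fmorph_inj iota); rewrite (iota_root_power_sum_split _ fs) rmorphN.
have [_ /(_ 1 isT)] := newton_pair_rev_prod s 1.
rewrite big_ord1 coef0_rev_prod mul1r mulr1 -(iota_coef_split _ fs) ?ss // subn1 => ->.
by rewrite opprK.
Qed.

(* By Newton's identities the [n]-th power sum of the roots depends on the constant coefficient
   only through the elementary symmetric function of degree [n]. *)
Lemma root_power_sum_addC n f c : (0 < n)%N -> size f = n.+1 ->
    splits iota f -> splits iota (f + c%:P) ->
  root_power_sum n (f + c%:P) = root_power_sum n f - n%:R * c.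
Proof.
case: n => // n _ sf [s fs] [t ft]; have sfc : size (f + c%:P) = n.+2.
  by rewrite size_polyDl ?sf // size_polyC; case: (c != 0).
have [ss st] := (size_split_roots fs sf, size_split_roots ft sfc).
have coefE i : (i <= n)%N -> (rev_prod t)`_i = (rev_prod s)`_i.
  move=> le_in; rewrite -(iota_coef_split _ fs) ?ss ?leqW // -(iota_coef_split _ ft) ?st ?leqW //.
  by rewrite coefD coefC subSn // addr0.
have := newton_pair_top (newton_pair_rev_prod t n.+1) (newton_pair_rev_prod s n.+1) coefE.
rewrite -(iota_coef_split _ fs) ?ss // -(iota_coef_split _ ft) ?st // subnn coefD coefC /=.
rewrite -(iota_root_power_sum_split _ fs) -(iota_root_power_sum_split _ ft).
rewrite -!(rmorph_nat iota) -!rmorphM -!rmorphD /= => /fmorph_inj/(canRL (addrK _)) ->.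
ring.
Qed.

Lemma prod_traject x k : \prod_(y <- traject fr x k) y = x ^+ (\sum_(i < k) #|F| ^ i).
Proof.
elim: k x => [|k IHk] x; first by rewrite big_nil big_ord0.
rewrite /= big_cons IHk big_ord_recl expn0 exprD expr1 /frob -exprM; congr (_ * _ ^+ _).
by rewrite big_distrr /=; apply: eq_bigr => i _; rewrite -expnS.
Qed.

Lemma iota_root_prod_norm k x : iter k fr x = x ->
  iota (root_prod (norm_poly k x)) = x ^+ (\sum_(i < k) #|F| ^ i).
Proof. by move=> xk; rewrite (iota_root_prod_split (map_norm_poly xk)) prod_traject. Qed.

Lemma root_prod_normX k x n : iter k fr x = x ->
  root_prod (norm_poly k (x ^+ n)) = root_prod (norm_poly k x) ^+ n.
Proof.
move=> xk; apply: (fmorph_inj iota); rewrite rmorphXn /= !iota_root_prod_norm //.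
  by rewrite exprAC.
by rewrite iter_frobX xk.
Qed.

Lemma root_power_sum_normX k x n : iter k fr x = x ->
  root_power_sum 1 (norm_poly k (x ^+ n)) = root_power_sum n (norm_poly k x).
Proof.
move=> xk; apply: (fmorph_inj iota).
have xnk : iter k fr (x ^+ n) = x ^+ n by rewrite iter_frobX xk.
rewrite (iota_root_power_sum_split n (map_norm_poly xk)).
rewrite (iota_root_power_sum_split 1 (map_norm_poly xnk)) /power_sum.
elim: (k) (x) => [|j IHj] y; first by rewrite !big_nil.
by rewrite /= !big_cons expr1 -IHj /frob exprAC.
Qed.

Lemma iter_frob_prim_root k z : (#|F| ^ k - 1).-primitive_root z -> iter k fr z = z.
Proof.
move=> z_prim.
by rewrite iter_frobE card_finField_expr_pred exprS (prim_expr_order z_prim) mulr1.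
Qed.

Lemma sum_frob_fixed (V : nmodType) (H : L -> V) k z : (#|F| ^ k - 1).-primitive_root z ->
  H 0 = 0 -> \sum_(x | iter k fr x == x) H x = \sum_(i < #|F| ^ k - 1) H (z ^+ i).
Proof.
move=> z_prim H0; set N := (#|F| ^ k - 1)%N in z_prim *.
rewrite (bigID (pred1 0)) /= [X in X + _]big1 ?add0r => [|x /andP[_ /eqP ->] //].
have unity_rootE x : (iter k fr x == x) && (x != 0) = (x ^+ N == 1).
  rewrite iter_frobE card_finField_expr_pred -/N exprS; have [->|x0] := eqVneq x 0.
    by rewrite andbF expr0n gtn_eqF ?(prim_order_gt0 z_prim) // eq_sym oner_eq0.
  by rewrite andbT -[X in _ == X]mulr1 (inj_eq (mulfI x0)).
rewrite (eq_bigl _ _ unity_rootE).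
rewrite -(big_map (fun i : 'I_N => z ^+ i) xpredT H) -big_filter.
apply: perm_big; apply: uniq_perm; first by rewrite filter_uniq // index_enum_uniq.
  rewrite map_inj_uniq ?index_enum_uniq // => i j /eqP.
  by rewrite (eq_prim_root_expr z_prim) !modn_small // => /eqP/val_inj.
move=> x; rewrite mem_filter mem_index_enum andbT; apply/eqP/mapP => [|[i _ ->]].
  by move=> /(prim_rootP z_prim)[i ->]; exists i => //; rewrite mem_index_enum.
by rewrite exprAC (prim_expr_order z_prim) expr1n.
Qed.

Lemma norm_prim_root k z : (#|F| ^ k - 1).-primitive_root z ->
  (#|F| - 1).-primitive_root (root_prod (norm_poly k z)).
Proof.
move=> z_prim; have zk := iter_frob_prim_root z_prim.
rewrite -(fmorph_primitive_root iota) iota_root_prod_norm //.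
set G := (\sum_(i < k) _)%N.
have factor : (#|F| ^ k - 1 = (#|F| - 1) * G)%N by rewrite !subn1 predn_exp.
have G0 : (0 < G)%N by move: (prim_order_gt0 z_prim); rewrite factor muln_gt0 => /andP[].
have := exp_prim_root z_prim G.
by rewrite factor (gcdn_idPl (dvdn_mull _ (dvdnn G))) mulnK.
Qed.

End Frobenius.

(** * Characters of a finite field and their Gauss sums *)

Lemma sum_unity_root (R : idomainType) n (v : R) : v ^+ n = 1 ->
  \sum_(i < n) v ^+ i = (v == 1)%:R * n%:R.
Proof.
move=> vn; have [->|v1] := eqVneq v 1.
  by under eq_bigr => i _ do rewrite expr1n; rewrite sumr_const card_ord mul1r.
have v1' : v - 1 != 0 by rewrite subr_eq0.
by apply: (mulfI v1'); rewrite -subrX1 vn subrr mul0r mulr0.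
Qed.

Lemma mulr_fixed_eq0 (R : idomainType) (a s : R) : a != 1 -> a * s = s -> s = 0.
Proof.
move=> a1 as_s; have a1' : a - 1 != 0 by rewrite subr_eq0.
by apply: (mulfI a1'); rewrite mulrBl mul1r as_s subrr mulr0.
Qed.

Record mulchar (F : finFieldType) (A : F -> algC) : Prop := MulChar {
  mulchar0 : A 0 = 0;
  mulchar1 : A 1 = 1;
  mulcharM : forall x y, A (x * y) = A x * A y }.

Record nontriv_addchar (F : finFieldType) (theta : F -> algC) : Prop := NontrivAddChar {
  addchar0 : theta 0 = 1;
  addcharD : forall x y, theta (x + y) = theta x * theta y;
  addchar_neq1 : exists a, theta a != 1 }.

Section MulChar.
Variable F : finFieldType.
Implicit Types (A B : F -> algC) (x y : F).

Definition nontriv_mulchar A : Prop := exists2 x, x != 0 & A x != 1.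

Definition mulchar_order m A : Prop :=
  forall g : F, (#|F| - 1).-primitive_root g -> m.-primitive_root (A g).

Definition cinv A x : algC := (A x)^-1.

(* At [0] and for [k = 0] the bare power would be [0 ^ 0 = 1]. *)
Definition cpow A (k : int) x : algC := if x == 0 then 0 else A x ^ k.

Lemma mulcharX A x n : mulchar A -> A (x ^+ n) = A x ^+ n.
Proof. by move=> [_ A1 AM]; elim: n => [|n IHn]; rewrite ?A1 // !exprS AM IHn. Qed.

Lemma mulchar_neq0 A x : mulchar A -> x != 0 -> A x != 0.
Proof.
move=> [_ A1 AM] x0; apply: contra_neq (oner_neq0 algC) => Ax.
by rewrite -A1 -(mulfV x0) AM Ax mul0r.
Qed.

Lemma mulcharV A x : mulchar A -> A x^-1 = (A x)^-1.
Proof.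
move=> A_char; have [->|x0] := eqVneq x 0; first by rewrite invr0 (mulchar0 A_char) invr0.
apply: (mulfI (mulchar_neq0 A_char x0)).
by rewrite -(mulcharM A_char) !mulfV ?(mulchar1 A_char) ?mulchar_neq0.
Qed.

Lemma mulchar_order_dvd m A : mulchar A -> mulchar_order m A -> (m %| #|F| - 1)%N.
Proof.
move=> A_char A_order; have [g g_prim] := finField_prim_root F.
rewrite (prim_order_dvd (A_order g g_prim)) -mulcharX //.
by rewrite (prim_expr_order g_prim) (mulchar1 A_char).
Qed.

Lemma mulcharN1_sqr A : mulchar A -> A (-1) ^+ 2 = 1.
Proof. by move=> A_char; rewrite -mulcharX // sqrrN expr1n (mulchar1 A_char). Qed.

Lemma mulchar_cmul A B : mulchar A -> mulchar B -> mulchar (cmul A B).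
Proof.
move=> [A0 A1 AM] [_ B1 BM]; split=> [||x y]; first by rewrite /cmul A0 mul0r.
  by rewrite /cmul A1 B1 mul1r.
by rewrite /cmul AM BM mulrACA.
Qed.

Lemma mulchar_cinv A : mulchar A -> mulchar (cinv A).
Proof. by move=> [A0 A1 AM]; split=> [||x y]; rewrite /cinv ?A0 ?A1 ?invr0 ?invr1 ?AM ?invfM. Qed.

Lemma mulchar_epsc : mulchar (@epsc F).
Proof.
split=> [||x y]; rewrite /epsc ?eqxx ?oner_eq0 // mulf_eq0.
by have [_|_] := eqVneq x 0; rewrite ?mul0r //= mul1r.
Qed.

Lemma cpow0 A k : cpow A k 0 = 0. Proof. by rewrite /cpow eqxx. Qed.

Lemma cpow_nat A n x : x != 0 -> cpow A n%:Z x = A x ^+ n.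
Proof. by rewrite /cpow => /negPf ->. Qed.

Lemma cpow_pos_nat A n x : mulchar A -> (0 < n)%N -> cpow A n%:Z x = A x ^+ n.
Proof.
move=> A_char n0; have [->|] := eqVneq x 0; last exact: cpow_nat.
by rewrite cpow0 (mulchar0 A_char) expr0n gtn_eqF.
Qed.

Lemma mulchar_cpow A k : mulchar A -> mulchar (cpow A k).
Proof.
move=> [_ A1 AM]; split=> [||x y]; first exact: cpow0.
  by rewrite /cpow oner_eq0 A1 exp1rz.
rewrite /cpow mulf_eq0 AM; have [->|x0] := eqVneq x 0; first by rewrite mul0r.
by have [->|y0] := eqVneq y 0; rewrite ?mulr0 //= expfzMl.
Qed.

Lemma cpowD A k l x : mulchar A -> cpow A (k + l) x = cpow A k x * cpow A l x.
Proof.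
move=> A_char; rewrite /cpow; have [_|x0] := eqVneq x 0; first by rewrite mul0r.
by rewrite expfzDr // mulchar_neq0.
Qed.

Lemma cpowN A k x : cpow A (- k) x = (cpow A k x)^-1.
Proof. by rewrite /cpow; case: eqVneq; rewrite ?invr0 // invr_expz. Qed.

Lemma cpow_neq0 A k x : mulchar A -> x != 0 -> cpow A k x != 0.
Proof. by move=> A_char; apply/mulchar_neq0/mulchar_cpow. Qed.

Lemma cpowMn A k n x : mulchar A -> (0 < n)%N -> cpow A (k *+ n) x = cpow A k x ^+ n.
Proof.
move=> A_char; case: n => // n _; elim: n => [|n IHn]; first by rewrite mulr1n expr1.
by rewrite mulrS cpowD // IHn -exprS.
Qed.

Lemma cpowX A k n x : mulchar A -> (0 < n)%N -> cpow A k (x ^+ n) = cpow A (k *+ n) x.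
Proof. by move=> A_char n0; rewrite cpowMn // mulcharX //; apply: mulchar_cpow. Qed.

Lemma cpow_doubleN1 A k : mulchar A -> cpow A (k + k) (-1) = 1.
Proof. by move=> A_char; rewrite cpowD // -expr2 mulcharN1_sqr //; apply: mulchar_cpow. Qed.

Lemma sum_nontriv_mulchar A : mulchar A -> nontriv_mulchar A -> \sum_x A x = 0.
Proof.
move=> A_char [a a0 Aa]; apply: (mulr_fixed_eq0 Aa).
rewrite [RHS](reindex_inj (mulfI a0)) mulr_sumr.
by apply: eq_bigr => x _; rewrite (mulcharM A_char).
Qed.

End MulChar.

Section GaussSums.
Variables (F : finFieldType) (theta : F -> algC).
Hypothesis theta_char : nontriv_addchar theta.
Implicit Types (A B : F -> algC) (x y s : F).

Definition gauss A : algC := \sum_x A x * theta x.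

Lemma eq_gauss A B : A =1 B -> gauss A = gauss B.
Proof. by move=> AB; apply: eq_bigr => x _; rewrite AB. Qed.

Lemma sum_addchar : \sum_x theta x = 0.
Proof.
have [a ta] := addchar_neq1 theta_char; apply: (mulr_fixed_eq0 ta).
rewrite [RHS](reindex_inj (addrI a)) mulr_sumr.
by apply: eq_bigr => x _; rewrite (addcharD theta_char).
Qed.

Lemma sum_addchar_scale s : \sum_y theta (y * s) = if s == 0 then #|F|%:R else 0.
Proof.
have [->|s0] := eqVneq s 0; last by rewrite -[RHS]sum_addchar [RHS](reindex_inj (mulIf s0)).
by under eq_bigr => y _ do rewrite mulr0 (addchar0 theta_char); rewrite sumr_const.
Qed.

Lemma gauss_epsc : gauss (@epsc F) = -1.
Proof.
have := sum_addchar; rewrite /gauss (bigD1 0) //= (addchar0 theta_char) => /eqP.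
rewrite addrC addr_eq0 => /eqP <-; rewrite (bigD1 0) //= /epsc eqxx mul0r add0r.
by apply: eq_bigr => x /negPf ->; rewrite mul1r.
Qed.

Lemma gauss_scale A s : mulchar A -> s != 0 -> \sum_x A x * theta (s * x) = (A s)^-1 * gauss A.
Proof.
move=> A_char s0; rewrite /gauss [in RHS](reindex_inj (mulfI s0)) mulr_sumr.
by apply: eq_bigr => x _; rewrite (mulcharM A_char) !mulrA mulVf ?mul1r ?mulchar_neq0.
Qed.

Lemma gauss_scale_nontriv A s : mulchar A -> nontriv_mulchar A ->
  \sum_x A x * theta (s * x) = (A s)^-1 * gauss A.
Proof.
move=> A_char A_nontriv; have [->|s0] := eqVneq s 0; last exact: gauss_scale.
under eq_bigr => x _ do rewrite mul0r (addchar0 theta_char) mulr1.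
by rewrite sum_nontriv_mulchar // (mulchar0 A_char) invr0 mul0r.
Qed.

Lemma gauss_conj A : mulchar A -> nontriv_mulchar A ->
  gauss A * gauss (cinv A) = A (-1) * #|F|%:R.
Proof.
move=> A_char A_nontriv; rewrite {2}/gauss mulr_sumr.
have expand y : gauss A * (cinv A y * theta y) = \sum_x A x * theta (y * (x + 1)).
  rewrite mulrA [gauss A * _]mulrC -gauss_scale_nontriv // mulr_suml.
  by apply: eq_bigr => x _; rewrite -mulrA -(addcharD theta_char) mulrDr mulr1.
under eq_bigr => y _ do rewrite expand.
rewrite exchange_big /= (bigD1 (-1)) //= -mulr_sumr sum_addchar_scale addNr eqxx.
rewrite big1 ?addr0 // => x x1; rewrite -mulr_sumr sum_addchar_scale addr_eq0 (negPf x1).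
exact: mulr0.
Qed.

Lemma gauss_nontriv_neq0 A : mulchar A -> nontriv_mulchar A -> gauss A != 0.
Proof.
move=> A_char A_nontriv; apply: contra_neq (_ : A (-1) * #|F|%:R != 0) => [G0|].
  by rewrite -gauss_conj // G0 mul0r.
by rewrite mulf_neq0 ?mulchar_neq0 ?oppr_eq0 ?oner_eq0 // pnatr_eq0 -lt0n ltnW ?finNzRing_gt1.
Qed.

Lemma gauss_jacobi A B : mulchar A -> mulchar B -> nontriv_mulchar (cmul A B) ->
  gauss A * gauss B = (\sum_x A x * B (1 - x)) * gauss (cmul A B).
Proof.
move=> A_char B_char AB_nontriv; have AB_char := mulchar_cmul A_char B_char.
have convolve : gauss A * gauss B = \sum_s theta s * \sum_x A x * B (s - x).
  rewrite /gauss mulr_suml.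
  under eq_bigr => x _ do rewrite mulr_sumr (reindex_inj (addIr (- x))) /=.
  rewrite exchange_big /=; apply: eq_bigr => s _; rewrite mulr_sumr; apply: eq_bigr => x _.
  by rewrite mulrACA -(addcharD theta_char) subrKC mulrC.
rewrite convolve /gauss mulr_sumr; apply: eq_bigr => s _.
rewrite mulrC mulrA; congr (_ * _); have [->|s0] := eqVneq s 0.
  rewrite (mulchar0 AB_char) mulr0 -[RHS](mulr0 (B (-1))).
  rewrite -[in RHS](sum_nontriv_mulchar AB_char) // mulr_sumr; apply: eq_bigr => x _.
  by rewrite /cmul sub0r -[- x]mulN1r (mulcharM B_char) mulrCA.
rewrite (reindex_inj (mulfI s0)) mulr_suml; apply: eq_bigr => x _ /=.
by rewrite -{2}[s]mulr1 -mulrBr (mulcharM A_char) (mulcharM B_char) /cmul; ring.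
Qed.

Lemma jbin_gauss A B : mulchar A -> mulchar B -> nontriv_mulchar (cmul A (cinv B)) ->
  jbin A B = B (-1) / #|F|%:R * (gauss A * gauss (cinv B) / gauss (cmul A (cinv B))).
Proof.
move=> A_char B_char nontriv; have Bi_char := mulchar_cinv B_char.
rewrite gauss_jacobi // mulfK //; apply: gauss_nontriv_neq0 => //.
exact: mulchar_cmul.
Qed.

End GaussSums.

Lemma exists_nontriv_addchar (F : finFieldType) : exists theta : F -> algC, nontriv_addchar theta.
Proof.
pose G := [set: F]%G; have abG : abelian G by apply: FinRing.zmod_abelian.
have [i i0] : exists i : Iirr G, i != 0.
  have : (1 < #|Iirr G|)%N by rewrite card_Iirr_abelian // cardsT finNzRing_gt1.
  move=> /card_gt1P[i [j [_ _ ij]]]; have [i0|i0] := eqVneq i 0; last by exists i.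
  by exists j; rewrite -i0 eq_sym.
have lin : 'chi_i \is a linear_char by apply/char_abelianP.
exists 'chi_i; split; first exact: lin_char1.
- by move=> x y; rewrite -[x + y]/(x * y)%g lin_charM ?inE.
apply/existsP; apply: contraR i0 => /existsPn chi1.
apply/eqP/irr_inj; rewrite irr0; apply/cfunP => x.
by rewrite cfun1E inE; apply/eqP; rewrite -[_ == _]negbK chi1.
Qed.

Lemma eq_jbin (F : finFieldType) (A A' B B' : F -> algC) :
  A =1 A' -> B =1 B' -> jbin A B = jbin A' B'.
Proof.
by move=> AA BB; rewrite /jbin BB; congr (_ * _); apply: eq_bigr => x _; rewrite AA BB.
Qed.

(** * L-functions of multiplicative functions on monic polynomials *)

Section LFunction.
Variables (F L : finFieldType) (iota : {rmorphism F -> L}).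
Variables (R : comNzRingType) (Lam : {poly F} -> R).
Hypothesis Lam1 : Lam 1 = 1.
Hypothesis LamM : forall f g, f \is monic -> g \is monic -> Lam (f * g) = Lam f * Lam g.

Local Notation fr := (frob iota).
Local Notation norm_poly := (norm_poly iota).

Definition monic_sum n : R := \sum_(v : 'rV[F]_n) Lam (monic_rV v).
Definition norm_sum k : R := \sum_(x : L | iter k fr x == x) Lam (norm_poly k x).

Lemma monic_sum0 : monic_sum 0 = 1.
Proof.
rewrite /monic_sum (big_pred1 0) => [|v]; last by apply/esym/eqP/matrixP => i [].
by rewrite /monic_rV linear0 addr0 expr0 Lam1.
Qed.

(* The recurrence is the logarithmic derivative of the L-function, compared coefficientwise. *)
Lemma newton_pair_monic_sum m :
    (forall f, f \is monic -> (size f <= m.+1)%N -> splits iota f) ->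
  newton_pair m monic_sum (fun k => - norm_sum k).
Proof.
move=> splitL; split=> [|n n_le_m]; first exact: monic_sum0.
under [in RHS]eq_bigr => i _ do rewrite mulNr.
rewrite sumrN opprK mulr_sumr.
transitivity (\sum_(v : 'rV[F]_n) \sum_(x : L) \sum_(i < n | iter i.+1 fr x == x)
    if norm_poly i.+1 x %| monic_rV v then Lam (monic_rV v) else 0).
  apply: eq_bigr => v _; have v_size := size_monic_rV v.
  have v_splits : splits iota (monic_rV v) by apply: splitL; rewrite ?monic_rV_monic ?v_size.
  rewrite (sum_mup_split _ v_splits v_size) mulr_suml; apply: eq_bigr => x _.
  rewrite (mup_eq_count_norm_poly _ _ v_size) natr_sum mulr_suml [RHS]big_mkcond.
  apply: eq_bigr => i _; case: ifP => _ /=; last by rewrite mul0r.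
  by case: ifP => _; rewrite ?mul1r ?mul0r.
rewrite exchange_big /=; under eq_bigr => x _ do rewrite exchange_big.
rewrite (exchange_big_dep xpredT) //=; apply: eq_bigr => i _.
rewrite mulr_suml; apply: eq_bigr => x /eqP xi.
have P_monic := norm_poly_monic (k := i.+1) xi.
rewrite -big_mkcond /= (sum_monic_dvd _ P_monic (size_norm_poly (k := i.+1) xi)) // mulr_sumr.
by apply: eq_bigr => w _; rewrite LamM ?monic_rV_monic.
Qed.

End LFunction.

(** * The Hasse-Davenport product formula *)

Lemma sum_periodic (R : pzRingType) (f : nat -> R) r a : (forall i, f (i + r)%N = f i) ->
  \sum_(i < a * r) f i = a%:R * \sum_(i < r) f i.
Proof.
move=> f_per; have f_perM i b : f (b * r + i)%N = f i.
  by elim: b => // b IHb; rewrite mulSnr addnAC f_per IHb.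
elim: a => [|a IHa]; first by rewrite mul0n big_ord0 mul0r.
rewrite mulSnr big_split_ord /= IHa -natr1 mulrDl mul1r; congr (_ + _).
by apply: eq_bigr => i _; rewrite f_perM.
Qed.

Lemma sum_multiples (R : pzRingType) (f : nat -> R) m r : (0 < m)%N ->
  \sum_(i < m * r) (m %| i)%:R * f i = \sum_(i < r) f (m * i)%N.
Proof.
case: m => // m _; elim: r => [|r IHr]; first by rewrite muln0 !big_ord0.
rewrite mulnSr big_split_ord /= IHr [in RHS]big_ord_recr /=; congr (_ + _).
rewrite big_ord_recl /= addn0 dvdn_mulr // mul1r big1 ?addr0 // => i _.
by rewrite dvdn_addr ?dvdn_mulr // gtnNdvd ?mul0r //; apply: (ltn_ord (lift ord0 i)).
Qed.

Lemma sum_prim_root_twist (R : idomainType) (f : nat -> R) m r (w : R) :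
    m.-primitive_root w -> (forall i, f (i + m * r)%N = f i) ->
  \sum_(i < m * r) f (m * i)%N = \sum_(j < m) \sum_(i < m * r) f i * (w ^+ i) ^+ j.
Proof.
move=> w_prim f_per; have m0 := prim_order_gt0 w_prim.
rewrite (@sum_periodic _ (fun i => f (m * i)%N) r) => [|i]; last by rewrite mulnDr f_per.
rewrite -sum_multiples // mulr_sumr exchange_big; apply: eq_bigr => i _ /=.
rewrite -mulr_sumr sum_unity_root; last by rewrite exprAC (prim_expr_order w_prim) expr1n.
by rewrite -(prim_order_dvd w_prim); ring.
Qed.

Section RootCharacters.
Variables (F L : finFieldType) (iota : {rmorphism F -> L}) (m : nat) (theta : F -> algC).
Hypothesis splitL : forall f, f \is monic -> (size f <= m.+1)%N -> splits iota f.
Hypothesis primL : forall k, (0 < k <= m)%N -> exists z : L, (#|F| ^ k - 1).-primitive_root z.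
Hypothesis theta_char : nontriv_addchar theta.
Implicit Types (eta : F -> algC) (f g : {poly F}).

Local Notation fr := (frob iota).
Local Notation norm_poly := (norm_poly iota).

Definition root_char eta n f : algC :=
  eta (root_prod f) ^+ n * theta (root_power_sum iota n f).

Lemma root_char_poly1 eta n : mulchar eta -> root_char eta n 1 = 1.
Proof.
move=> eta_char; rewrite /root_char root_prod1 root_power_sum1.
by rewrite (mulchar1 eta_char) (addchar0 theta_char) expr1n mulr1.
Qed.

Lemma root_charM eta n f g : mulchar eta -> f \is monic -> g \is monic ->
  root_char eta n (f * g) = root_char eta n f * root_char eta n g.
Proof.
move=> eta_char f_monic g_monic; rewrite /root_char root_prodM // root_power_sumM //.
by rewrite (mulcharM eta_char) exprMn (addcharD theta_char) mulrACA.
Qed.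

Lemma newton_pair_root_char eta n : mulchar eta ->
  newton_pair m (monic_sum (root_char eta n)) (fun k => - norm_sum iota (root_char eta n) k).
Proof.
move=> eta_char; apply: newton_pair_monic_sum => //; first exact: root_char_poly1.
by move=> f g; apply: root_charM.
Qed.

Lemma root_char_normX eta n k x : mulchar eta -> iter k fr x = x ->
  root_char eta 1 (norm_poly k (x ^+ n)) = root_char eta n (norm_poly k x).
Proof.
move=> eta_char xk; rewrite /root_char root_prod_normX // root_power_sum_normX //.
by rewrite (mulcharX _ _ eta_char) expr1.
Qed.

Lemma splits_monic_rV n (v : 'rV[F]_n) : (n <= m)%N -> splits iota (monic_rV v).
Proof. by move=> nm; apply: splitL; rewrite ?monic_rV_monic ?size_monic_rV. Qed.

Lemma root_prod_monic_rV n (v : 'rV[F]_n.+1) :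
  root_prod (monic_rV v) = (-1) ^+ n.+1 * v 0 ord0.
Proof. by rewrite /root_prod size_monic_rV -(coef_monic_rV v ord0). Qed.

Lemma root_power_sum_monic_rV n (v : 'rV[F]_n.+1) : (n < m)%N ->
  root_power_sum iota 1 (monic_rV v) = - v 0 ord_max.
Proof.
move=> nm; rewrite (root_power_sum_linear (n := n)) ?size_monic_rV //.
  by rewrite -(coef_monic_rV v ord_max).
exact: splits_monic_rV.
Qed.

Lemma monic_sum_root_char_deg1 eta : (0 < m)%N ->
  monic_sum (root_char eta 1) 1 = gauss theta eta.
Proof.
move=> m0; rewrite /monic_sum /gauss (reindex (fun x : F => (- x)%:M : 'rV[F]_1)) /=.
  apply: eq_bigr => x _; rewrite /root_char root_prod_monic_rV root_power_sum_monic_rV //.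
  by rewrite !mxE !expr1 mulN1r opprK.
exists (fun v : 'rV[F]_1 => - v 0 0) => [x _|v _]; first by rewrite mxE opprK.
by rewrite opprK -mx11_scalar.
Qed.

(* Shifting the coefficient below the leading one multiplies the sum by a value of [theta]. *)
Lemma monic_sum_root_char_deg_gt1 eta n : (1 < n <= m)%N -> monic_sum (root_char eta 1) n = 0.
Proof.
case: n => // -[//|n] /= nm; have [a ta] := addchar_neq1 theta_char.
apply: (mulr_fixed_eq0 ta); rewrite /monic_sum mulr_sumr.
rewrite [RHS](reindex_inj (addrI (- a *: delta_mx 0 ord_max))) /=.
apply: eq_bigr => v _; rewrite /root_char !root_prod_monic_rV !root_power_sum_monic_rV // !mxE.
by rewrite !eqxx mulr0 mulr1 add0r opprD opprK (addcharD theta_char) !expr1 mulrCA.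
Qed.

Lemma monic_sum_root_char1 eta k : mulchar eta -> (k <= m)%N ->
  monic_sum (root_char eta 1) k = (rev_prod [:: - gauss theta eta])`_k.
Proof.
move=> eta_char km; have [c0 _] := newton_pair_root_char 1 eta_char.
case: k km => [|[|k]] km; first by rewrite c0 coef0_rev_prod.
  rewrite monic_sum_root_char_deg1 // coefS_rev_prod_cons /rev_prod big_nil.
  by rewrite !coef1 /= mulr1 sub0r opprK.
rewrite monic_sum_root_char_deg_gt1 // nth_default //.
exact: leq_trans (size_rev_prod _) _.
Qed.

Lemma norm_sum_root_char1 eta k : mulchar eta -> (0 < k <= m)%N ->
  norm_sum iota (root_char eta 1) k = - (- gauss theta eta) ^+ k.
Proof.
move=> eta_char /andP[k0 km]; apply: oppr_inj; rewrite opprK.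
rewrite (newton_pair_eq_power (newton_pairW km (newton_pair_root_char 1 eta_char))
  (newton_pair_rev_prod [:: - gauss theta eta] k)) //; first by rewrite /power_sum big_seq1.
by move=> i ik; rewrite monic_sum_root_char1 // (leq_trans ik).
Qed.

Lemma norm_sum_root_charE eta n k z : mulchar eta -> (0 < n)%N -> (0 < k)%N ->
    (#|F| ^ k - 1).-primitive_root z ->
  norm_sum iota (root_char eta n) k =
  \sum_(i < #|F| ^ k - 1) root_char eta n (norm_poly k (z ^+ i)).
Proof.
move=> eta_char n0 k0 z_prim.
rewrite /norm_sum (sum_frob_fixed iota (H := fun x => root_char eta n (norm_poly k x)) z_prim) //.
rewrite /root_char; suff -> : root_prod (norm_poly k (0 : L)) = 0.
  by rewrite (mulchar0 eta_char) expr0n gtn_eqF // mul0r.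
apply: (fmorph_inj iota); rewrite rmorph0 iota_root_prod_norm.
  by case: (k) k0 => // k' _; rewrite big_ord_recl expn0 expr0n.
by rewrite iter_frobE expr0n gtn_eqF // card_finField_expr_pred.
Qed.

Variable chi : F -> algC.
Hypothesis chi_char : mulchar chi.
Hypothesis chi_order : mulchar_order m chi.

Local Notation twist eta j := (cmul eta (cpow chi (Posz j))).

Lemma mulchar_twist eta j : mulchar eta -> mulchar (twist eta j).
Proof. by move=> eta_char; apply/mulchar_cmul/mulchar_cpow. Qed.

Lemma norm_sum_twist eta k : mulchar eta -> (0 < k <= m)%N ->
  norm_sum iota (root_char eta m) k =
  \sum_(j < m) norm_sum iota (root_char (twist eta j) 1) k.
Proof.
move=> eta_char km; have /andP[k0 k_le_m] := km; have m0 := leq_trans k0 k_le_m.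
have [z z_prim] := primL km.
have z_fixed := iter_frob_prim_root iota z_prim.
have zX_fixed i : iter k fr (z ^+ i) = z ^+ i by rewrite iter_frobX z_fixed.
have Nz_prim := norm_prim_root iota z_prim.
set Nz := root_prod (norm_poly k z) in Nz_prim.
pose H i := root_char eta 1 (norm_poly k (z ^+ i)).
have HX i : root_char eta m (norm_poly k (z ^+ i)) = H (m * i)%N.
  by rewrite /H mulnC exprM root_char_normX.
have twistE i j : root_char (twist eta j) 1 (norm_poly k (z ^+ i)) = H i * (chi Nz ^+ i) ^+ j.
  rewrite /H /root_char !expr1 /cmul cpow_nat root_prod_normX // -/Nz.
    by rewrite (mulcharX _ _ chi_char) mulrAC.
  by rewrite expf_neq0 ?(prim_root_neq0 Nz_prim).
have [a aE] : exists a, (#|F| ^ k - 1 = m * a)%N.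
  have /dvdnP[b bE] := mulchar_order_dvd chi_char chi_order.
  exists (b * \sum_(i < k) #|F| ^ i)%N.
  by rewrite mulnA [(m * b)%N]mulnC -bE !subn1 predn_exp.
rewrite (norm_sum_root_charE eta_char m0 k0 z_prim).
under [LHS]eq_bigr => i _ do rewrite HX.
under [RHS]eq_bigr => j _.
  rewrite (norm_sum_root_charE (mulchar_twist _ eta_char) _ k0 z_prim) //.
  under eq_bigr => i _ do rewrite twistE.
  over.
rewrite aE; apply: (sum_prim_root_twist (f := H)) (chi_order Nz_prim) _ => i.
by rewrite /H exprD -aE (prim_expr_order z_prim) mulr1.
Qed.

Lemma prod_gauss_monic_sum eta : mulchar eta ->
  \prod_(j < m) gauss theta (twist eta j) = monic_sum (root_char eta m) m.
Proof.
move=> eta_char; pose s := [seq - gauss theta (twist eta j) | j : 'I_m].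
have s_size : size s = m by rewrite size_map -cardE card_ord.
have power_sumE k : (0 < k <= m)%N -> - norm_sum iota (root_char eta m) k = power_sum s k.
  move=> km; rewrite /power_sum big_map big_enum norm_sum_twist // -sumrN.
  by apply: eq_bigr => j _; rewrite norm_sum_root_char1 ?opprK //; exact: mulchar_twist.
rewrite (newton_pair_eq_coef (newton_pair_root_char m eta_char) (newton_pair_rev_prod s m)) //.
rewrite -[m in _`_m]s_size -coef_prod_XsubC_rev // subnn coef0_prod big_map big_enum.
by apply: eq_bigr => j _; rewrite coefB coefX coefC sub0r opprK.
Qed.

Definition Hasse_Davenport_constant : algC :=
  \sum_(v : 'rV[F]_m | (monic_rV v)`_0 == 0) theta (root_power_sum iota m (monic_rV v)).

(* Changing the constant coefficient by [c] changes the [m]-th power sum of the roots by [- m c]: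
   this makes the top coefficient factor. *)
Lemma monic_sum_root_char_top eta : (0 < m)%N ->
  monic_sum (root_char eta m) m =
  Hasse_Davenport_constant * \sum_c eta ((-1) ^+ m * c) ^+ m * theta (- m%:R * c).
Proof.
move=> m0; rewrite /monic_sum (partition_big (fun v : 'rV_m => (monic_rV v)`_0) xpredT) //=.
rewrite mulr_sumr; apply: eq_bigr => c _.
rewrite (reindex_inj (addIr (poly_rV c%:P))) mulr_suml.
apply: eq_big => [v|v] /=; rewrite monic_rV_addC // coefD coefC eqxx.
  by rewrite -subr_eq0 addrK.
move=> /eqP v0; have v_splits := splits_monic_rV v (leqnn m).
have := splits_monic_rV (v + poly_rV c%:P) (leqnn m).
rewrite monic_rV_addC // => vc_splits; rewrite /root_char {1}/root_prod.
rewrite -monic_rV_addC // size_monic_rV monic_rV_addC // coefD coefC v0.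
rewrite root_power_sum_addC ?size_monic_rV // (addcharD theta_char).
by rewrite mulNr mulrCA.
Qed.

Lemma prod_gauss_Hasse_Davenport_constant eta : mulchar eta -> (0 < m)%N -> m%:R != 0 :> F ->
  \prod_(j < m) gauss theta (twist eta j) =
  Hasse_Davenport_constant * (eta m%:R ^+ m)^-1 * gauss theta (cpow eta m).
Proof.
move=> eta_char m0 mF; have etam_char := mulchar_cpow m eta_char.
rewrite prod_gauss_monic_sum // monic_sum_root_char_top // -mulrA; congr (_ * _).
under eq_bigr => c _ do rewrite -cpow_pos_nat // (mulcharM etam_char) -mulrA.
rewrite -mulr_sumr gauss_scale ?oppr_eq0 // -[- m%:R]mulN1r (mulcharM etam_char) mulrA.
congr (_ * _).
rewrite invfM mulrA -[RHS]mul1r (cpow_pos_nat m%:R) //; congr (_ * _).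
rewrite (mulcharX _ _ etam_char) cpow_pos_nat //.
have /eqP := mulcharN1_sqr eta_char; rewrite sqrf_eq1 => /orP[] /eqP ->.
  by rewrite !expr1n divr1.
by rewrite -exprM -signr_odd oddM andbb signr_odd mulfV // signr_eq0.
Qed.

End RootCharacters.


Section HasseDavenport.
Variables (F : finFieldType) (m : nat) (theta chi : F -> algC).
Hypothesis m_gt0 : (0 < m)%N.
Hypothesis theta_char : nontriv_addchar theta.
Hypothesis chi_char : mulchar chi.
Hypothesis chi_order : mulchar_order m chi.

Theorem Hasse_Davenport_product eta : mulchar eta ->
  \prod_(j < m) gauss theta (cmul eta (cpow chi j%:Z)) =
  (eta m%:R ^+ m)^-1 * gauss theta (cpow eta m)
    * \prod_(1 <= j < m) gauss theta (cpow chi j%:Z).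
Proof.
have [L [iota [splitL primL]]] := splitting_tower F m.
have mF : m%:R != 0 :> F.
  exact/natr_dvd_pred_neq0/(mulchar_order_dvd chi_char).
have prod_gaussE := prod_gauss_Hasse_Davenport_constant splitL primL theta_char chi_char chi_order.
have constE :
    \prod_(1 <= j < m) gauss theta (cpow chi j%:Z) = Hasse_Davenport_constant iota m theta.
  have := prod_gaussE _ (mulchar_epsc F) m_gt0 mF.
  have -> : gauss theta (cpow (@epsc F) m) = -1.
    rewrite -(gauss_epsc theta_char); apply: eq_gauss => x.
    rewrite (cpow_pos_nat x (mulchar_epsc F) m_gt0) /epsc.
    by case: ifP; rewrite ?expr1n // expr0n gtn_eqF.
  have -> : @epsc F m%:R = 1 by rewrite /epsc (negPf mF).
  rewrite expr1n invr1 mulr1 mulrN1.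
  rewrite -(big_mkord xpredT (fun j => gauss theta (cmul (@epsc F) (cpow chi j%:Z)))) big_ltn //.
  have epsc_twist j : gauss theta (cmul (@epsc F) (cpow chi j)) = gauss theta (cpow chi j).
    apply: eq_gauss => x; rewrite /cmul /epsc; have [->|_] := eqVneq x 0; last by rewrite mul1r.
    by rewrite cpow0 mul0r.
  have -> : gauss theta (cmul (@epsc F) (cpow chi 0)) = -1.
    by rewrite epsc_twist -(gauss_epsc theta_char); apply: eq_gauss => x.
  by under eq_bigr => j _ do rewrite epsc_twist; rewrite mulN1r => /oppr_inj.
by move=> eta_char; rewrite prod_gaussE // constE -mulrA mulrC.
Qed.

End HasseDavenport.

(** * Powers of a generating character *)

(* The factors pair off as [j] and [n - j], the middle one excepted. *)
Lemma prod_complementary (R : comNzRingType) (f : nat -> R) (x : R) n :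
    (forall j, (0 < j < n)%N -> j.*2 != n -> f j * f (n - j)%N = x) ->
  \prod_(1 <= j < n | j.*2 != n) f j = x ^+ n.-1./2.
Proof.
case: n => [|n] fx; first by rewrite big_geq.
rewrite (bigID (fun j => j.*2 < n.+1)%N) /=.
have -> : \prod_(1 <= j < n.+1 | (j.*2 != n.+1) && ~~ (j.*2 < n.+1)%N) f j =
    \prod_(1 <= j < n.+1 | (j.*2 != n.+1) && (j.*2 < n.+1)%N) f (n.+1 - j)%N.
  rewrite big_nat_rev /= big_nat_cond [RHS]big_nat_cond.
  apply: eq_big => j; rewrite ?add1n ?subSS //; lia.
rewrite -big_split /=.
transitivity (\prod_(1 <= j < n./2.+1) (f j * f (n.+1 - j)%N)).
  rewrite [RHS](big_nat_widen _ _ n.+1); last by lia.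
  by apply: eq_bigl => j; lia.
rewrite (eq_big_nat _ _ (F2 := fun=> x)) => [|j jn]; first by rewrite prodr_const_nat subSS subn0.
by apply: fx; lia.
Qed.

Lemma ndvdz_small n (z : int) : (0 < `|z| < n)%N -> ~~ (n %| z)%Z.
Proof. by move=> /andP[z0 zn]; rewrite dvdzE; apply/negP => /(dvdn_leq z0); rewrite leqNgt zn. Qed.

Section GeneratorPowers.
Variables (F : finFieldType) (theta t : F -> algC).
Hypothesis theta_char : nontriv_addchar theta.
Hypothesis t_char : mulchar t.
Hypothesis t_order : mulchar_order (#|F| - 1) t.
Implicit Types (k l z : int).

Local Notation q := #|F|.
Local Notation Q := (#|F| - 1)%N.
Local Notation X := (cpow t).
Local Notation G k := (gauss theta (cpow t k)).

Lemma mulchar_exp_pred_card x : x != 0 -> t x ^+ Q = 1.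
Proof. by move=> x0; rewrite -(mulcharX _ _ t_char) expf_pred_card ?(mulchar1 t_char). Qed.

Lemma generator_inj x : t x = 1 -> x = 1.
Proof.
have [g g_prim] := finField_prim_root F; have tg_prim := t_order g_prim.
have [->|x0] := eqVneq x 0; first by rewrite (mulchar0 t_char) => /esym/eqP; rewrite oner_eq0.
have [i ->] := prim_rootP g_prim (expf_pred_card x0).
rewrite (mulcharX _ _ t_char) => /eqP; rewrite -(prim_order_dvd tg_prim) (prim_order_dvd g_prim).
by move/eqP.
Qed.

Lemma cpow_order_dvd k x : (Q %| k)%Z -> X k x = (x != 0)%:R.
Proof.
move=> /dvdzP[a ->]; rewrite /cpow; case: eqVneq => //= x0.
by rewrite mulrC -exprz_exp -exprnP mulchar_exp_pred_card // exp1rz.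
Qed.

Lemma eq_cpow k l : (Q %| k - l)%Z -> X k =1 X l.
Proof.
move=> kl x; rewrite -[k](subrK l) cpowD // cpow_order_dvd //.
by have [->|_] := eqVneq x 0; rewrite ?cpow0 ?mulr0 // mul1r.
Qed.

Lemma eq_gauss_cpow k l : (Q %| k - l)%Z -> G k = G l.
Proof. by move=> kl; apply/eq_gauss/eq_cpow. Qed.

Lemma nontriv_cpow k : ~~ (Q %| k)%Z -> nontriv_mulchar (X k).
Proof.
move=> Qk; have [g g_prim] := finField_prim_root F; have tg_prim := t_order g_prim.
have g0 := prim_root_neq0 g_prim.
exists g => //; apply: contra Qk; rewrite /cpow (negPf g0) dvdzE (prim_order_dvd tg_prim).
by case: k => n; rewrite ?NegzE //= -exprnN invr_eq1.
Qed.

Lemma mulchar_order_cpow n u : (n * u)%N = Q -> mulchar_order n (X u%:Z).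
Proof.
move=> nu y y_prim; have Q0 := prim_order_gt0 y_prim.
rewrite cpow_nat ?(prim_root_neq0 y_prim) //; have := exp_prim_root (t_order y_prim) u.
have u0 : (0 < u)%N by move: Q0; rewrite -nu muln_gt0 => /andP[].
by rewrite -nu (gcdn_idPl (dvdn_mull _ (dvdnn u))) mulnK.
Qed.

Lemma gauss_cpow_mult n u k : (n * u)%N = Q ->
  \prod_(j < n) G (k + u%:Z *+ j) =
  (X (k *+ n) n%:R)^-1 * G (k *+ n) * \prod_(1 <= j < n) G (u%:Z *+ j).
Proof.
move=> nu; have [g g_prim] := finField_prim_root F.
have n0 : (0 < n)%N by move: (prim_order_gt0 g_prim); rewrite -nu muln_gt0 => /andP[].
have u_char := mulchar_cpow u t_char; have k_char := mulchar_cpow k t_char.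
have cpow_cpow j : cpow (X u%:Z) j%:Z =1 X (u%:Z *+ j).
  move=> x; have [->|x0] := eqVneq x 0; first by rewrite !cpow0.
  by rewrite !cpow_nat // -mulr_natr natz -PoszM cpow_nat // exprM.
have gauss_twist j : G (k + u%:Z *+ j) = gauss theta (cmul (X k) (cpow (X u%:Z) j%:Z)).
  by apply: eq_gauss => x; rewrite cpowD // /cmul cpow_cpow.
under [LHS]eq_bigr => j _ do rewrite gauss_twist.
rewrite (Hasse_Davenport_product n0 theta_char u_char (mulchar_order_cpow nu) k_char).
rewrite -cpowMn // (eq_gauss theta (B := X (k *+ n))) => [|x]; last first.
  by rewrite cpow_pos_nat // cpowMn.
by congr (_ * _); apply: eq_bigr => j _; apply/eq_gauss/cpow_cpow.
Qed.

Lemma gauss_cpow_conj k : ~~ (Q %| k)%Z -> G k * G (- k) = X k (-1) * q%:R.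
Proof.
move=> Qk; have k_char := mulchar_cpow k t_char.
rewrite -(gauss_conj theta_char k_char (nontriv_cpow Qk)); congr (_ * _).
by apply: eq_gauss => x; rewrite cpowN.
Qed.

Lemma gauss_double_conj z : ~~ (Q %| z + z)%Z -> G (z + z) * G (- (z + z)) = q%:R.
Proof. by move=> Qz; rewrite gauss_cpow_conj // cpow_doubleN1 // mul1r. Qed.

Lemma prod_gauss_double_powers n m : (n * m.*2)%N = Q ->
  \prod_(1 <= j < n | j.*2 != n) G (m.*2%:Z *+ j) = q%:R ^+ n.-1./2.
Proof.
move=> nmQ; apply: prod_complementary => j /andP[j0 jn] _.
have jE : m.*2%:Z *+ j = m%:Z *+ j + m%:Z *+ j by rewrite -mulrnDl -PoszD addnn.
have -> : G (m.*2%:Z *+ (n - j)) = G (- (m.*2%:Z *+ j)).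
  apply: eq_gauss_cpow; rewrite opprK -mulrnDr subnK ?(ltnW jn) //.
  by rewrite -mulr_natl natz -PoszM nmQ.
rewrite jE gauss_double_conj // -jE ndvdz_small // -mulr_natl natz -PoszM absz_nat.
have Q0 : (0 < Q)%N by rewrite subn_gt0 finNzRing_gt1.
by move: Q0; rewrite -nmQ muln_gt0 => /andP[n0 m0]; rewrite muln_gt0 j0 m0 ltn_pmul2r.
Qed.

Lemma jbin_cpow k l : ~~ (Q %| k - l)%Z ->
  jbin (X k) (X l) = X l (-1) / q%:R * (G k * G (- l) / G (k - l)).
Proof.
move=> kl; have [k_char l_char] := (mulchar_cpow k t_char, mulchar_cpow l t_char).
have quotE : cmul (X k) (cinv (X l)) =1 X (k - l) by move=> x; rewrite /cmul cpowD // cpowN.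
rewrite (jbin_gauss theta_char) //; last first.
  by have [x x0 X1] := nontriv_cpow kl; exists x; rewrite ?quotE.
rewrite (eq_gauss theta quotE) (eq_gauss theta (A := cinv (X l)) (B := X (- l))) // => x.
by rewrite cpowN.
Qed.

Lemma sum_cpow_nat x : \sum_(k < Q) X k%:Z x = (x == 1)%:R * Q%:R.
Proof.
have [->|x0] := eqVneq x 0.
  by rewrite eq_sym oner_eq0 mul0r big1 // => k _; rewrite cpow0.
under eq_bigr => k _ do rewrite cpow_nat //.
rewrite sum_unity_root ?mulchar_exp_pred_card //; congr (_%:R * _).
by congr nat_of_bool; apply/eqP/eqP => [/generator_inj //|->]; rewrite (mulchar1 t_char).
Qed.

Lemma fourier_inversion (W : F -> algC) b : b != 0 ->
  Q%:R * W b = \sum_(k < Q) X k%:Z b * \sum_y X (- k%:Z) y * W y.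
Proof.
move=> b0; under eq_bigr => k _ do rewrite mulr_sumr.
have sum_quot y : \sum_(k < Q) X k%:Z b * (X (- k%:Z) y * W y) = (y == b)%:R * Q%:R * W y.
  transitivity ((\sum_(k < Q) X k%:Z (b / y)) * W y).
    rewrite mulr_suml; apply: eq_bigr => k _; have k_char := mulchar_cpow k t_char.
    by rewrite mulrA cpowN (mulcharM k_char) (mulcharV _ k_char).
  rewrite sum_cpow_nat; congr (_%:R * _ * _); congr nat_of_bool.
  have [->|y0] := eqVneq y 0; first by rewrite invr0 mulr0 ![0 == _]eq_sym (negPf b0) oner_eq0.
  by rewrite -(inj_eq (mulIf y0)) mulfVK // mul1r eq_sym.
rewrite exchange_big (eq_bigr _ (fun y _ => sum_quot y)) (bigD1 b) //= eqxx mul1r.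
by rewrite big1 ?addr0 // => y /negPf ->; rewrite !mul0r.
Qed.

(* The substitution [s = w / x ^ n] separates the variables. *)
Lemma sum_trinomial_addchar j n a : (0 < n)%N -> a != 0 ->
  \sum_(x | x != 0) \sum_s X j s * theta ((x ^+ n.+1 + a * x ^+ n) * s) =
  (X (j *+ n.+1) a)^-1 * (G (- (j *+ n)) * G (j *+ n.+1)).
Proof.
move=> n0 a0; have charX k : mulchar (X k) by apply: mulchar_cpow.
have rescale x : x != 0 -> \sum_s X j s * theta ((x ^+ n.+1 + a * x ^+ n) * s) =
    \sum_w X (- (j *+ n)) x * theta (w * x) * (X j w * theta (a * w)).
  move=> x0; have xn0 : x ^+ n != 0 by rewrite expf_neq0.
  rewrite (reindex_inj (mulIf (invr_neq0 xn0))); apply: eq_bigr => w _ /=.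
  rewrite (mulcharM (charX j)) (mulcharV _ (charX j)) cpowX // -cpowN.
  have -> : (x ^+ n.+1 + a * x ^+ n) * (w / x ^+ n) = w * x + a * w by rewrite exprS; field.
  by rewrite (addcharD theta_char); ring.
rewrite (eq_bigr _ rescale) exchange_big /=.
rewrite mulrCA -gauss_scale // mulr_sumr; apply: eq_bigr => w _; rewrite -mulr_suml.
rewrite mulrS cpowD //; have [->|w0] := eqVneq w 0; first by rewrite !cpow0 !mul0r !mulr0.
have -> : \sum_(x | x != 0) X (- (j *+ n)) x * theta (w * x) = X (j *+ n) w * G (- (j *+ n)).
  rewrite -[X (j *+ n) w]invrK -cpowN -gauss_scale // [RHS](bigD1 0) //=.
  by rewrite cpow0 mul0r add0r.
ring.
Qed.

(* Multiplying by [G (- l)] replaces [X l] by additive characters, which turns the sum over [y]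
   into a Gauss sum. *)
Lemma trinomial_fourier_coef k l n a : ~~ (Q %| l)%Z -> (0 < n)%N -> a != 0 ->
  G (- l) * (\sum_y X (- k) y * \sum_(x | x != 0) X l (x ^+ n.+1 + a * x ^+ n + y)) =
  (X ((k - l) *+ n.+1) a)^-1 * (G (- k) * G (- ((k - l) *+ n)) * G ((k - l) *+ n.+1)).
Proof.
move=> Ql n0 a0; have charX j : mulchar (X j) by apply: mulchar_cpow.
have gauss_l w : G (- l) * X l w = \sum_s X (- l) s * theta (w * s).
  rewrite (gauss_scale_nontriv theta_char) ?cpowN ?invrK 1?mulrC //.
  by apply: nontriv_cpow; rewrite rpredN.
have absorb s : X (- l) s * \sum_y X (- k) y * theta (s * y) = G (- k) * X (k - l) s.
  have [->|s0] := eqVneq s 0; first by rewrite !cpow0 mul0r mulr0.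
  by rewrite gauss_scale // cpowD // !cpowN invrK; ring.
rewrite -mulrA mulrCA -sum_trinomial_addchar // !mulr_sumr.
under eq_bigr => y _ do rewrite mulrCA !mulr_sumr.
rewrite exchange_big /=; apply: eq_bigr => x _.
under eq_bigr => y _ do rewrite gauss_l mulr_sumr.
rewrite exchange_big mulr_sumr; apply: eq_bigr => s _ /=.
rewrite mulrA -absorb mulr_sumr mulr_suml; apply: eq_bigr => y _.
by rewrite mulrDl (addcharD theta_char) [y * s]mulrC; ring.
Qed.

Lemma phiq_cpow (m : nat) : (m + m)%N = Q -> @phiq F =1 X m%:Z.
Proof.
move=> mQ x; have [g g_prim] := finField_prim_root F; have tg_prim := t_order g_prim.
rewrite /phiq; have [->|x0] := eqVneq x 0; first by rewrite cpow0.
rewrite cpow_nat //; have [i xi] := prim_rootP g_prim (expf_pred_card x0).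
case: existsP => [[y /eqP yx]|not_square].
  have y0 : y != 0 by apply: contraNneq x0 => y0; rewrite -yx y0 expr0n.
  by rewrite -yx (mulcharX _ _ t_char) -exprM mul2n -addnn mQ mulchar_exp_pred_card.
have : (t x ^+ m) ^+ 2 == 1 by rewrite -exprM muln2 -addnn mQ mulchar_exp_pred_card.
rewrite sqrf_eq1 => /orP[] /eqP txm //; case: not_square.
have : (Q %| i * m)%N by rewrite (prim_order_dvd tg_prim) exprM -(mulcharX _ _ t_char) -xi txm.
have m0 : (0 < m)%N by have := prim_order_gt0 g_prim; rewrite -mQ addnn double_gt0.
rewrite -[X in (X %| _)%N]mQ addnn -mul2n dvdn_pmul2r // => /dvdnP[j ij].
by exists (g ^+ j); rewrite xi ij exprM.
Qed.

End GeneratorPowers.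

(** * Fourier coefficients of the curve and of the hypergeometric series *)

Lemma prod_middle (R : comNzRingType) (f : nat -> R) r :
  \prod_(1 <= j < r.*2.+2) f j = f r.+1 * \prod_(1 <= j < r.*2.+2 | j.*2 != r.*2.+2) f j.
Proof.
have r_mem : r.+1 \in index_iota 1 r.*2.+2 by rewrite mem_index_iota; lia.
rewrite (bigD1_seq r.+1 r_mem) ?iota_uniq //; congr (_ * _).
by apply: eq_bigl => j; lia.
Qed.

Section EvenDegree.
Variables (F : finFieldType) (theta t : F -> algC) (r c : nat).
Hypothesis theta_char : nontriv_addchar theta.
Hypothesis t_char : mulchar t.
Hypothesis t_order : mulchar_order (#|F| - 1) t.

Local Notation q := #|F|.
Local Notation Q := (#|F| - 1)%N.
Local Notation X := (cpow t).
Local Notation G k := (gauss theta (cpow t k)).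
Local Notation d := r.*2.+2.
Local Notation e := r.*2.+1.

(* [phi], [chi] and [psi] of the theorem as powers of the generator [t]. *)
Definition phi_exp : nat := d * e * c.
Definition chi_exp : nat := 2 * e * c.
Definition psi_exp : nat := d * c.
Local Notation h := (phi_exp%:Z).
Local Notation u := (chi_exp%:Z).
Local Notation v := (psi_exp%:Z).

Hypothesis units_factor : (Q = 2 * d * e * c)%N.

Let units_phi_exp : Q%:Z = 2 * h. Proof. by rewrite units_factor /phi_exp; clear; lia. Qed.

Let Q_gt0 : (0 < Q)%N. Proof. by rewrite subn_gt0 finNzRing_gt1. Qed.

Let q_neq0 : q%:R != 0 :> algC.
Proof. by rewrite pnatr_eq0 -lt0n ltnW ?finNzRing_gt1. Qed.

Let dvdQ x z : x = Q%:Z * z -> (Q %| x)%Z.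
Proof. by move=> ->; apply: dvdz_mulr. Qed.

Lemma chi_expE : (Q %/ d)%N = chi_exp.
Proof. by rewrite units_factor [(2 * _ * _)%N]mulnAC [(_ * _ * c)%N]mulnAC mulnK. Qed.

Lemma psi_expE : (Q %/ (2 * e))%N = psi_exp.
Proof. by rewrite units_factor [(2 * _ * _)%N]mulnAC -[(_ * _ * c)%N]mulnA mulKn. Qed.

Lemma phi_exp_double : (phi_exp + phi_exp)%N = Q.
Proof. by rewrite units_factor /phi_exp; clear; lia. Qed.

Lemma phi_exp_ndvd : ~~ (Q %| h)%Z.
Proof. by apply: ndvdz_small; move: Q_gt0; rewrite -phi_exp_double /=; lia. Qed.

Lemma cpow_double_addN1 z k : X (z + z + k) (-1) = X k (-1).
Proof. by rewrite cpowD // cpow_doubleN1 // mul1r. Qed.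

Lemma cpow_phi_expN1 k : X (h + k) (-1) = X k (-1).
Proof.
rewrite -[RHS](cpow_double_addN1 (r.+1 * e * c)%N); congr (X (_ + _) _).
by rewrite /phi_exp; clear; lia.
Qed.

Lemma gauss_phi_conj : G h * G (- h) = q%:R.
Proof.
rewrite (gauss_cpow_conj theta_char t_char t_order phi_exp_ndvd) -[h]addr0 cpow_phi_expN1.
by rewrite cpow_order_dvd // oppr_eq0 oner_eq0 mul1r.
Qed.

Definition curve_coef a k : algC :=
  \sum_y X (- k) y * \sum_(x | x != 0) X h (x ^+ d + a * x ^+ e + y).

Lemma curve_coefE a k : a != 0 ->
  q%:R * curve_coef a k =
  (X (k *+ d) a)^-1 * (G h * G (- k) * G (k *+ d) * G (h - k *+ e)).
Proof.
move=> a0; rewrite -gauss_phi_conj -mulrA (trinomial_fourier_coef _ t_char) ?phi_exp_ndvd //.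
have d_dvd : (Q %| (k - h) *+ d - k *+ d)%Z.
  by apply: (@dvdQ _ (- r.+1%:Z)); rewrite units_phi_exp; lia.
have e_dvd : (Q %| - ((k - h) *+ e) - (h - k *+ e))%Z.
  by apply: (@dvdQ _ r); rewrite units_phi_exp; lia.
rewrite (eq_cpow t_char d_dvd) (eq_gauss_cpow _ t_char d_dvd) (eq_gauss_cpow _ t_char e_dvd); ring.
Qed.

Definition hyper_coef k : algC :=
  jbin (X (h + k)) (X k) * (jbin (X k) (X (h + k)) *
    \prod_(1 <= j < d | j.*2 != d) jbin (X (u *+ j + k)) (X (v *+ (2 * j - 1) + k))).

Lemma prod_gauss_chi : \prod_(1 <= j < d) G (u *+ j) = G h * q%:R ^+ r.
Proof.
rewrite prod_middle; congr (G _ * _); first by rewrite /chi_exp /phi_exp; lia.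
have -> : chi_exp = (e * c).*2 by rewrite /chi_exp -mulnA mul2n.
rewrite (prod_gauss_double_powers theta_char t_char t_order); last by rewrite units_factor; lia.
by congr (_ ^+ _); lia.
Qed.

Lemma prod_gauss_psi_sqr : \prod_(1 <= j < e) G (psi_exp.*2%:Z *+ j) = q%:R ^+ r.
Proof.
rewrite (eq_bigl (fun j => j.*2 != e)) => [|j]; last by lia.
rewrite (prod_gauss_double_powers theta_char t_char t_order) /= ?doubleK //.
by rewrite units_factor /psi_exp; lia.
Qed.

(* Half of the exponent of [chi ^ j / psi ^ (2 * j - 1)]. *)
Definition half_gap (j : nat) : int := c%:Z * (r.+1%:Z - j%:Z).

Lemma half_gap_ndvd j : (0 < j < d)%N -> j.*2 != d ->
  ~~ (Q %| half_gap j + half_gap j)%Z.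
Proof.
move=> jd j_mid; apply: ndvdz_small.
have -> : half_gap j + half_gap j = (2 * c)%N%:Z * (r.+1%:Z - j%:Z) by rewrite /half_gap; lia.
rewrite abszM absz_nat; have : (0 < `|r.+1%:Z - j%:Z| <= 2 * r)%N by lia.
by move: Q_gt0; rewrite units_factor; nia.
Qed.

Lemma prod_gauss_half_gap :
  \prod_(1 <= j < d | j.*2 != d) G (half_gap j + half_gap j) = q%:R ^+ r.
Proof.
rewrite (prod_complementary (x := q%:R)) => [|j jd j_mid]; first by congr (_ ^+ _); lia.
have -> : half_gap (d - j) = - half_gap j by rewrite /half_gap; lia.
by rewrite -opprD gauss_double_conj // half_gap_ndvd.
Qed.

Lemma prod_gauss_top k :
  G (h + k) * (G k * \prod_(1 <= j < d | j.*2 != d) G (u *+ j + k)) =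
  (X (k *+ d) d%:R)^-1 * G (k *+ d) * (G h * q%:R ^+ r).
Proof.
rewrite -prod_gauss_chi -(gauss_cpow_mult theta_char t_char t_order); last first.
  by rewrite units_factor /chi_exp; lia.
rewrite -(big_mkord xpredT (fun j => G (k + u *+ j))) big_ltn // mulr0n addr0 mulrCA; congr (_ * _).
rewrite prod_middle; congr (_ * _); last by apply: eq_bigr => j _; rewrite addrC.
by congr (G _); rewrite addrC; congr (_ + _); rewrite /chi_exp /phi_exp; lia.
Qed.

Lemma prod_gauss_bottom k :
  G (- (h + k)) * \prod_(1 <= j < d | j.*2 != d) G (- (v *+ (2 * j - 1) + k)) =
  X h e%:R * X (k *+ e) e%:R * G (h - k *+ e) * q%:R ^+ r.
Proof.
pose l := - (v *+ (2 * e - 1) + k).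
have l_mod : (Q %| l *+ e - (h - k *+ e))%Z.
  by apply: (@dvdQ _ (- e%:Z)); rewrite units_factor /l /phi_exp /psi_exp; lia.
have -> : X h e%:R * X (k *+ e) e%:R = (X (l *+ e) e%:R)^-1.
  rewrite (eq_cpow t_char l_mod) -cpowN -cpowD //.
  by apply: (eq_cpow t_char); apply: (@dvdQ _ 1); rewrite units_phi_exp; ring.
rewrite -(eq_gauss_cpow _ t_char l_mod) -prod_gauss_psi_sqr.
rewrite -(gauss_cpow_mult theta_char t_char t_order); last by rewrite units_factor /psi_exp; lia.
transitivity (\prod_(1 <= j < d) G (- (v *+ (2 * j - 1) + k))).
  rewrite prod_middle; congr (G (- (_ + _)) * _).
  by rewrite /phi_exp /psi_exp; lia.
rewrite big_add1 big_mkord (reindex_inj rev_ord_inj); apply: eq_bigr => j _ /=.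
have split_exp : (2 * e - 1 = 2 * (e - j.+1).+1 - 1 + 2 * j)%N by have := ltn_ord j; lia.
by congr (G _); rewrite /l split_exp -[psi_exp.*2]addnn PoszD mulrnDr mulrnA; ring.
Qed.

Lemma jbin_phi_epsc k :
  jbin (X (h + k)) (X k) = X k (-1) / q%:R * (G (h + k) * G (- k) / G h).
Proof. by rewrite (jbin_cpow theta_char t_char t_order) ?addrK ?phi_exp_ndvd. Qed.

Lemma jbin_epsc_phi k :
  jbin (X k) (X (h + k)) = X k (-1) / q%:R * (G k * G (- (h + k)) / G (- h)).
Proof.
have diffE : k - (h + k) = - h by ring.
by rewrite (jbin_cpow theta_char t_char t_order) diffE ?rpredN ?phi_exp_ndvd // cpow_phi_expN1.
Qed.

Lemma prod_jbin_side k :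
  \prod_(1 <= j < d | j.*2 != d) jbin (X (u *+ j + k)) (X (v *+ (2 * j - 1) + k)) =
  (\prod_(1 <= j < d | j.*2 != d) G (u *+ j + k)) *
  (\prod_(1 <= j < d | j.*2 != d) G (- (v *+ (2 * j - 1) + k))) / (q%:R ^+ r) ^+ 3.
Proof.
have s2 : X k (-1) / q%:R * (X k (-1) / q%:R) = (q%:R ^+ 2)^-1.
  by rewrite mulrACA -invfM -!expr2 mulcharN1_sqr ?mul1r //; apply: mulchar_cpow.
have sideE j : (0 < j < d)%N -> j.*2 != d ->
    jbin (X (u *+ j + k)) (X (v *+ (2 * j - 1) + k)) = X k (-1) / q%:R *
      (G (u *+ j + k) * G (- (v *+ (2 * j - 1) + k)) / G (half_gap j + half_gap j)).
  case: j => // j jd j_mid; have -> : (2 * j.+1 - 1 = 2 * j + 1)%N by lia.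
  have diffE : u *+ j.+1 + k - (v *+ (2 * j + 1) + k) = half_gap j.+1 + half_gap j.+1.
    by rewrite /half_gap /chi_exp /psi_exp; lia.
  rewrite (jbin_cpow theta_char t_char t_order) diffE ?half_gap_ndvd //; congr (_ / _ * _).
  rewrite -[RHS](cpow_double_addN1 (r.+1 * c * (2 * j + 1))%N); congr (X (_ + _) _).
  by rewrite /psi_exp; lia.
move: (X k (-1) / q%:R) s2 sideE => s s2 sideE.
transitivity (\prod_(1 <= j < d | j.*2 != d) (s *
    (G (u *+ j + k) * G (- (v *+ (2 * j - 1) + k)) / G (half_gap j + half_gap j)))).
  by rewrite big_nat_cond [RHS]big_nat_cond; apply: eq_bigr => j /andP[]; apply: sideE.
rewrite !big_split /= prodfV prod_gauss_half_gap (prod_complementary (fun _ _ _ => s2)).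
rewrite /= (_ : uphalf _ = r) ?exprVn; last by lia.
by rewrite -!exprM [(2 * r)%N]mulnC [(r * 3)%N]mulnSr exprD invfM; ring.
Qed.

Lemma hyper_coefE k : q%:R ^+ (r + 3) * hyper_coef k =
  X h e%:R * X (k *+ e) e%:R * (X (k *+ d) d%:R)^-1
    * (G h * G (- k) * G (k *+ d) * G (h - k *+ e)).
Proof.
rewrite /hyper_coef jbin_phi_epsc jbin_epsc_phi prod_jbin_side exprD.
have := mulcharN1_sqr (mulchar_cpow k t_char).
have := gauss_phi_conj; have := prod_gauss_top k; have := prod_gauss_bottom k.
have /andP[Gh GNh] : (G h != 0) && (G (- h) != 0).
  by rewrite -negb_or -mulf_eq0 gauss_phi_conj q_neq0.
have := expf_neq0 r q_neq0; move: (q%:R ^+ r) => qr qr0.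
set top := \prod_(1 <= j < d | _) G (_ + k); set bottom := \prod_(1 <= j < d | _) _.
move: (X k (-1)) ((X (k *+ d) d%:R)^-1) => s Xd_inv bottomE topE phiE s2.
transitivity (s ^+ 2 * G (- k) * (G (h + k) * (G k * top)) * (G (- (h + k)) * bottom)
    * (q%:R / (G h * G (- h))) / qr ^+ 2); first by field; rewrite q_neq0 qr0 Gh GNh.
by rewrite bottomE topE phiE s2; field; rewrite q_neq0 qr0.
Qed.

Lemma hyper_curve_coef a b k : a != 0 ->
  q%:R ^+ (r + 2) * X h e%:R *
    (hyper_coef k * X k (b * d%:R ^+ d / (a ^+ d * e%:R ^+ e))) =
  X k b * curve_coef a k.
Proof.
move=> a0; have k_char := mulchar_cpow k t_char.
have dF : d%:R != 0 :> F.
  by apply: natr_dvd_pred_neq0; rewrite units_factor -mulnA dvdn_mulr // dvdn_mull.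
have eF : e%:R != 0 :> F.
  by apply: natr_dvd_pred_neq0; rewrite units_factor dvdn_mulr // dvdn_mull.
have phi_e_sqr : X h e%:R * X h e%:R = 1.
  by rewrite -cpowD // cpow_order_dvd ?eF // -PoszD phi_exp_double.
rewrite (mulcharM k_char _ _^-1) (mulcharV _ k_char) (mulcharM k_char b).
rewrite (mulcharM k_char (a ^+ d)) !cpowX //.
apply: (mulfI q_neq0); rewrite [RHS]mulrCA curve_coefE //.
transitivity (q%:R ^+ (r + 3) * hyper_coef k * X h e%:R *
    (X k b * X (k *+ d) d%:R / (X (k *+ d) a * X (k *+ e) e%:R))).
  by rewrite [(r + 3)%N]addnS [q%:R ^+ (r + 2).+1]exprS; ring.
rewrite hyper_coefE.
have [Xd Xe] := (cpow_neq0 (k *+ d) t_char dF, cpow_neq0 (k *+ e) t_char eF).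
move: (G h) (X h e%:R) phi_e_sqr => Gh phi_e phi_e_sqr.
transitivity (phi_e * phi_e * (X k b * ((X (k *+ d) a)^-1 *
  (Gh * G (- k) * G (k *+ d) * G (h - k *+ e))))); last by rewrite phi_e_sqr mul1r.
by field; rewrite Xd Xe cpow_neq0.
Qed.

Lemma sum_curve_hyper_coef a b : a != 0 -> b != 0 ->
  Q%:R * \sum_(x | x != 0) X h (x ^+ d + a * x ^+ e + b) =
  q%:R ^+ (r + 2) * X h e%:R *
    \sum_(k < Q) hyper_coef k%:Z * X k%:Z (b * d%:R ^+ d / (a ^+ d * e%:R ^+ e)).
Proof.
move=> a0 b0.
rewrite (fourier_inversion t_char t_order
  (fun y => \sum_(x | x != 0) X h (x ^+ d + a * x ^+ e + y)) b0).
by rewrite mulr_sumr; apply: eq_bigr => k _; rewrite hyper_curve_coef.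
Qed.

End EvenDegree.

(** * Characters of the unit group *)

Section LinearCharGenerator.
Variables (gT : finGroupType) (G : {group gT}) (T : 'CF(G)).
Hypothesis abG : abelian G.
Hypothesis T_lin : T \is a linear_char.
Hypothesis T_gen : forall xi : 'CF(G), xi \is a linear_char -> exists k : nat, xi = T ^+ k.

Lemma lin_char_gen_exp_card : T ^+ #|G| = 1.
Proof.
apply/cfun_inP => x Gx.
by rewrite exp_cfunE // -lin_charX // expg_cardG // lin_char1 // cfun1E Gx.
Qed.

Lemma lin_char_gen_inj x : x \in G -> T x = 1 -> x = 1%g.
Proof.
move=> Gx Tx; apply/set1gP; rewrite -(TI_cfker_irr G); apply/bigcapP => i _.
have lin_i : 'chi_i \is a linear_char by apply/char_abelianP.
have [k kE] := T_gen lin_i.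
by rewrite cfkerEchar ?irr_char // inE Gx kE !exp_cfunE // Tx (lin_char1 T_lin) !expr1n eqxx.
Qed.

Lemma sum_Iirr_gen (E : 'CF(G) -> algC) :
  \sum_(i : Iirr G) E 'chi_i = \sum_(k < #|G|) E (T ^+ k).
Proof.
pose f (k : 'I_#|G|) : Iirr G := cfIirr (T ^+ k).
have fE k : 'chi_(f k) = T ^+ k by rewrite cfIirrE // lin_char_irr // rpredX.
have f_surj i : exists k, f k = i.
  have lin_i : 'chi_i \is a linear_char by apply/char_abelianP.
  have [k kE] := T_gen lin_i; exists (Ordinal (ltn_pmod k (cardG_gt0 G))).
  apply: irr_inj; rewrite fE kE /= [in RHS](divn_eq k #|G|) exprD mulnC exprM.
  by rewrite lin_char_gen_exp_card expr1n mul1r.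
have f_inj : injective f.
  apply: in2T; apply/image_injP/eqP; rewrite card_ord -[RHS](card_Iirr_abelian abG).
  by apply: eq_card => i; have [k <-] := f_surj i; rewrite !inE codom_f.
have [|f' fK f'K] := inj_card_bij f_inj; first by rewrite (card_Iirr_abelian abG) card_ord.
rewrite (reindex f); last by exists f' => i _.
by apply: eq_bigr => k _; rewrite fE.
Qed.

End LinearCharGenerator.

Section Mch.
Variable F : finFieldType.
Implicit Types (xi T : 'CF(UG F)) (x : F).

Lemma mch_unit xi (a : {unit F}) : mch xi (val a) = xi a.
Proof. by rewrite /mch valK. Qed.

Lemma mch0 xi : mch xi 0 = 0.
Proof. by rewrite /mch insubN // unitr0. Qed.

Lemma neq0_val_unit x : x != 0 -> exists a : {unit F}, x = val a.
Proof. by rewrite -unitfE => xU; exists (FinRing.Unit xU). Qed.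

Lemma abelian_UG : abelian (UG F).
Proof. exact/cyclic_abelian/field_unit_group_cyclic. Qed.

Lemma card_UG : #|UG F| = (#|F| - 1)%N.
Proof. by rewrite card_finField_unit subn1. Qed.

Lemma mulchar_mch xi : xi \is a linear_char -> mulchar (mch xi).
Proof.
move=> xi_lin; split; first exact: mch0.
  by rewrite -[1]/(val (1%g : {unit F})) mch_unit lin_char1.
move=> x y; have [->|x0] := eqVneq x 0; first by rewrite mul0r mch0 mul0r.
have [->|y0] := eqVneq y 0; first by rewrite mulr0 mch0 mulr0.
have [[a ->] [b ->]] := (neq0_val_unit x0, neq0_val_unit y0).
by rewrite -FinRing.val_unitM !mch_unit lin_charM ?inE.
Qed.

Lemma mch_exp xi k : mch (xi ^+ k) =1 cpow (mch xi) k%:Z.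
Proof.
move=> x; have [->|x0] := eqVneq x 0; first by rewrite cpow0 mch0.
by rewrite cpow_nat //; have [a ->] := neq0_val_unit x0; rewrite !mch_unit exp_cfunE ?inE.
Qed.

Variable T : 'CF(UG F).
Hypothesis T_lin : T \is a linear_char.
Hypothesis T_gen : forall xi : 'CF(UG F), xi \is a linear_char -> exists k : nat, xi = T ^+ k.

Lemma mulchar_order_mch : mulchar_order (#|F| - 1) (mch T).
Proof.
move=> g g_prim; have T_char := mulchar_mch T_lin.
have TgX n : mch T (g ^+ n) = mch T g ^+ n := mulcharX _ _ T_char.
have TgQ : mch T g ^+ (#|F| - 1) = 1 by rewrite -TgX (prim_expr_order g_prim) (mulchar1 T_char).
have [n n_prim n_dvd] := prim_order_exists (prim_order_gt0 g_prim) TgQ.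
suff <- : n = (#|F| - 1)%N by [].
apply/eqP; rewrite eqn_dvd n_dvd (prim_order_dvd g_prim).
have gn0 : g ^+ n != 0 by rewrite expf_neq0 ?(prim_root_neq0 g_prim).
have := TgX n; rewrite (prim_expr_order n_prim); have [a ->] := neq0_val_unit gn0.
by rewrite mch_unit => /(lin_char_gen_inj abelian_UG T_lin T_gen (in_setT a)) ->; apply: eqxx.
Qed.

Lemma HGF_generator (A0 : F -> algC) ABs x :
  HGF A0 ABs x = #|F|%:R / (#|F| - 1)%:R * \sum_(k < #|F| - 1)
    (jbin (cmul A0 (cpow (mch T) k%:Z)) (cpow (mch T) k%:Z) *
     \prod_(AB <- ABs)
       jbin (cmul AB.1 (cpow (mch T) k%:Z)) (cmul AB.2 (cpow (mch T) k%:Z)) *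
     cpow (mch T) k%:Z x).
Proof.
rewrite /HGF natrB ?(ltnW (finNzRing_gt1 F)) //; congr (_ * _).
pose E xi := jbin (cmul A0 (mch xi)) (mch xi) *
  \prod_(AB <- ABs) jbin (cmul AB.1 (mch xi)) (cmul AB.2 (mch xi)) * mch xi x.
rewrite (sum_Iirr_gen abelian_UG T_lin T_gen E) card_UG; apply: eq_bigr => k _.
have cmul_mch B : cmul B (mch (T ^+ k)) =1 cmul B (cpow (mch T) k%:Z).
  by move=> y; rewrite /cmul mch_exp.
rewrite /E mch_exp (eq_jbin (cmul_mch A0) (mch_exp T k)); congr (_ * _ * _).
by apply: eq_bigr => AB _; apply: eq_jbin.
Qed.

Lemma HGF_hyper_coef r c x :
    (#|F| - 1 = 2 * r.*2.+2 * r.*2.+1 * c)%N ->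
  let chi := T ^+ chi_exp r c in let psi := T ^+ psi_exp r c in
  let ABs := (@epsc F, @phiq F) :: [seq (mch (chi ^+ j), mch (psi ^+ (2 * j - 1)))
    | j <- iota 1 r.*2.+1 & j != r.+1] in
  HGF (@phiq F) ABs x = #|F|%:R / (#|F| - 1)%:R *
    \sum_(k < #|F| - 1) hyper_coef (mch T) r c k%:Z * cpow (mch T) k%:Z x.
Proof.
move=> units_factor chi psi ABs; have T_char := mulchar_mch T_lin.
have cmul_pow A l k : A =1 cpow (mch T) l ->
    cmul A (cpow (mch T) k) =1 cpow (mch T) (l + k).
  by move=> Al y; rewrite cpowD // /cmul Al.
have expE n j : mch ((T ^+ n) ^+ j) =1 cpow (mch T) (n%:Z *+ j).
  by move=> y; rewrite -exprM mch_exp -mulr_natr natz PoszM.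
have phiE := phiq_cpow T_char mulchar_order_mch (phi_exp_double units_factor).
rewrite HGF_generator; congr (_ * _); apply: eq_bigr => k _; congr (_ * _).
rewrite /hyper_coef /ABs big_cons big_map big_filter; congr (_ * (_ * _)).
- by apply: eq_jbin => //; apply: cmul_pow.
- apply: eq_jbin; last exact: cmul_pow.
  move=> y; rewrite /cmul /= /epsc; have [->|_] := eqVneq y 0; last by rewrite mul1r.
  by rewrite cpow0 mulr0.
rewrite [RHS](eq_bigl (fun j => j != r.+1)) => [|j]; last by lia.
by apply: eq_bigr => j _; apply: eq_jbin; apply/cmul_pow/expE.
Qed.

End Mch.

Lemma sum_sqrt_phiq (F : finFieldType) (x : F) : 2%:R != 0 :> F ->
  \sum_(y : F) (y ^+ 2 == x)%:R = 1 + phiq x.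
Proof.
move=> F2; rewrite /phiq; have [->|x0] := eqVneq x 0.
  rewrite addr0 (bigD1 0) //= expr0n eqxx big1 ?addr0 // => y y0.
  by rewrite sqrf_eq0 (negPf y0).
case: existsP => [[z /eqP zx]|not_square]; last first.
  by rewrite subrr big1 // => y _; case: eqP => // yx; case: not_square; exists y; apply/eqP.
have z0 : z != 0 by apply: contraNneq x0 => z0; rewrite -zx z0 expr0n.
have Nzz : - z != z.
  by rewrite -subr_eq0 -opprD oppr_eq0 -mulr2n -mulr_natl mulf_neq0.
rewrite (bigD1 z) //= zx eqxx (bigD1 (- z)) //= sqrrN zx eqxx big1 ?addr0 //.
by move=> y /andP[yz yNz]; rewrite -zx eqf_sqr (negPf yz) (negPf yNz).
Qed.

Lemma card_double_cover (F : finFieldType) (f : F -> F) : 2%:R != 0 :> F ->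
  #|[set xy : F * F | xy.2 ^+ 2 == f xy.1]|%:R = #|F|%:R + \sum_x phiq (f x) :> algC.
Proof.
move=> F2; rewrite -sum1_card natr_sum big_mkcond /=.
rewrite (eq_bigr (fun xy : F * F => (xy.2 ^+ 2 == f xy.1)%:R)) => [|xy _]; last first.
  by rewrite inE; case: ifP.
rewrite -(pair_big xpredT xpredT (fun x y : F => (y ^+ 2 == f x)%:R)) /=.
under eq_bigr => x _ do rewrite sum_sqrt_phiq //.
by rewrite big_split sumr_const.
Qed.

Lemma even_degree_decomp d n : (2 <= d)%N -> ~~ odd d -> (0 < n)%N ->
    n = 1 %[mod 2 * d * (d - 1)] ->
  exists r c, d = r.*2.+2 /\ (n - 1 = 2 * r.*2.+2 * r.*2.+1 * c)%N.
Proof.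
move=> d2 d_even n0 /eqP; rewrite eqn_mod_dvd // => /dvdnP[c nE].
have [r dE] : exists r, d = r.*2.+2 by exists d./2.-1; lia.
by exists r, c; split=> //; rewrite nE mulnC dE subn1.
Qed.

Theorem theorem1p3 (F : finFieldType) (p e : nat) (Hp : prime p) (Hq : #|F| = (p ^ e)%N)
  (d : nat) (Hd : (2 <= d)%N) (Hdeven : ~~ odd d)
  (Hqd : #|F| = 1 %[mod 2 * d * (d - 1)])
  (a b : F) (Ha : a != 0) (Hb : b != 0)
  (T : 'CF(UG F)) (HT : T \is a linear_char)
  (HTgen : forall xi : 'CF(UG F), xi \is a linear_char -> exists k : nat, xi = T ^+ k) :
  let q := #|F| in
  let chi := T ^+ ((q - 1) %/ d) in
  let psi := T ^+ ((q - 1) %/ (2 * (d - 1))) in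
  let beta := b * (d%:R) ^+ d / (a ^+ d * ((d - 1)%:R) ^+ (d - 1)) in
  let ABs := (@epsc F, @phiq F) ::
     [seq (mch (chi ^+ j), mch (psi ^+ (2 * j - 1))) | j <- iota 1 (d - 1) & j != d./2] in
  (#|[set xy : F * F | xy.2 ^+ 2 == xy.1 ^+ d + a * xy.1 ^+ (d - 1) + b]|)%:R
  = (q%:R : algC) + @phiq F b
    + (q%:R) ^+ (d./2) * @phiq F ((d - 1)%:R) * HGF (@phiq F) ABs beta.
Proof.
move=> q chi psi beta ABs; have q0 : (0 < #|F|)%N := ltnW (finNzRing_gt1 F).
have [r [c [dE units_factor]]] := even_degree_decomp Hd Hdeven q0 Hqd.
have T_char := mulchar_mch HT; have T_order := mulchar_order_mch HT HTgen.
have [theta theta_char] := exists_nontriv_addchar F.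
have phiE := phiq_cpow T_char T_order (phi_exp_double units_factor).
have F2 : 2%:R != 0 :> F.
  by apply: natr_dvd_pred_neq0; rewrite units_factor -!mulnA dvdn_mulr.
have Q0 : (#|F| - 1)%:R != 0 :> algC by rewrite pnatr_eq0 -lt0n subn_gt0 finNzRing_gt1.
have half_d : (r.*2.+2)./2 = r.+1 by rewrite -doubleS doubleK.
rewrite {}/ABs {}/beta {}/psi {}/chi {}/q dE half_d subn1.
rewrite (chi_expE units_factor) (psi_expE units_factor).
rewrite (card_double_cover (fun x => x ^+ _ + a * x ^+ _ + b) F2) HGF_hyper_coef //.
rewrite (bigD1 0) //= !expr0n mulr0 !add0r addrA; congr (_ + _).
apply: (mulfI Q0); under eq_bigr => x _ do rewrite phiE.
rewrite (sum_curve_hyper_coef theta_char T_char T_order units_factor Ha Hb) phiE addnS addn1 exprS.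
by field.
Qed.
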